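(* Let $k$ be an algebraically closed field of arbitrary characteristic. If $H$ is a finite-dimensional cosemisimple quasitriangular Hopf algebra over $k$ and $J$ is a twist for $H$, then the twisted Hopf algebra $H^J$ is also cosemisimple and quasitriangular.
   Context: Let $\Delta,\varepsilon,S$ be the comultiplication, counit and antipode of $H$. A twist for $H$ is an invertible $J\in H\otimes H$ with $(\Delta\otimes\mathrm{id})(J)(J\otimes 1)=(\mathrm{id}\otimes\Delta)(J)(1\otimes J)$, normalized by $(\varepsilon\otimes\mathrm{id})(J)=(\mathrm{id}\otimes\varepsilon)(J)=1$. Write $J=J^{(1)}\otimes J^{(2)}$ (summation understood) and $Q_J=S(J^{(1)})J^{(2)}$, which is invertible. The twisted Hopf algebra $H^J$ has the same algebra structure and counit as $H$, comultiplication $\Delta^J(h)=J^{-1}\Delta(h)J$ and antipode $S^J(h)=Q_J^{-1}S(h)Q_J$. Quasitriangular means that the Hopf algebra admits a universal $R$-matrix. *)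

(* Defs.v *)
From HB Require Import structures.
From mathcomp Require Import all_boot all_order all_algebra all_field.

Set Implicit Arguments.
Unset Strict Implicit.
Unset Printing Implicit Defensive.

Import GRing.Theory.
Local Open Scope ring_scope.

(* [A ⊗ B] is the space of coordinate matrices in the basis [e_i ⊗ f_j], where
   [e] and [f] are the bases [vbasis] of [A] and [B]. *)
Definition tens (k : fieldType) (A B : falgType k) : Type :=
  'M[k]_(\dim {:A}, \dim {:B}).

Notation "A ⊗ B" := (tens A B) (at level 40, left associativity) : type_scope.

HB.instance Definition _ (k : fieldType) (A B : falgType k) :=
  Vector.copy (A ⊗ B)%type 'M[k]_(\dim {:A}, \dim {:B}).

Definition ptens (k : fieldType) (A B : falgType k) (a : A) (b : B) :
    (A ⊗ B)%type :=
  \matrix_(i, j) (coord (vbasis {:A}) i a * coord (vbasis {:B}) j b).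

Notation "a ⊗ b" := (ptens a b) (at level 40, left associativity) : ring_scope.

(* For a bilinear [f], [tlift f] is the linear map sending [a ⊗ b] to [f a b]:
   in Sweedler's notation [tlift f t] is [f t^(1) t^(2)], summation understood.
   No meaning is attached to [tlift f] when [f] is not bilinear. *)
Definition tlift (k : fieldType) (A B : falgType k) (V : lmodType k)
    (f : A -> B -> V) (t : (A ⊗ B)%type) : V :=
  \sum_(i < \dim {:A}) \sum_(j < \dim {:B})
    t i j *: f (vbasis {:A})`_i (vbasis {:B})`_j.

Definition bilin (k : fieldType) (U V W : lmodType k) (f : U -> V -> W) : Prop :=
  (forall v, linear (f^~ v)) /\ (forall u, linear (f u)).

Section LinearClosure.
Variables (k : fieldType) (X : lmodType k).

Lemma lin_id : linear (fun x : X => x). Proof. by []. Qed.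

Lemma lin_app (V W : lmodType k) (g : {linear V -> W}) (f : X -> V) :
  linear f -> linear (fun x => g (f x)).
Proof. by move=> lf c u v; rewrite /= lf linearP. Qed.

Lemma lin_mull (A : algType k) (f : X -> A) a :
  linear f -> linear (fun x => f x * a).
Proof. by move=> lf c u v; rewrite /= lf mulrDl scalerAl. Qed.

Lemma lin_mulr (A : algType k) (f : X -> A) a :
  linear f -> linear (fun x => a * f x).
Proof. by move=> lf c u v; rewrite /= lf mulrDr scalerAr. Qed.

Lemma lin_scalel (V W : lmodType k) (e : {scalar V}) (f : X -> V) (w : W) :
  linear f -> linear (fun x => e (f x) *: w).
Proof. by move=> lf c u v; rewrite /= lf linearP /= scalerDl scalerA. Qed.

Lemma lin_scaler (V : lmodType k) c (f : X -> V) :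
  linear f -> linear (fun x => c *: f x).
Proof.
by move=> lf d u v; rewrite /= lf scalerDr !scalerA mulrC.
Qed.

Lemma lin_ptensl (A B : falgType k) (f : X -> A) (b : B) :
  linear f -> linear (fun x => f x ⊗ b).
Proof.
move=> lf c u v; apply/matrixP => i j; rewrite !mxE /= lf.
by rewrite linearP /= mulrDl mulrA.
Qed.

Lemma lin_ptensr (A B : falgType k) (f : X -> B) (a : A) :
  linear f -> linear (fun x => a ⊗ f x).
Proof.
move=> lf c u v; apply/matrixP => i j; rewrite !mxE /= lf.
by rewrite linearP /= mulrDr mulrCA.
Qed.

Lemma lin_tlift_fun (A B : falgType k) (V : lmodType k)
    (F : X -> A -> B -> V) t :
  (forall a b, linear (fun x => F x a b)) -> linear (fun x => tlift (F x) t).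
Proof.
move=> lF c u v; rewrite /tlift scaler_sumr -big_split; apply: eq_bigr => i _.
rewrite scaler_sumr -big_split; apply: eq_bigr => j _.
by rewrite /= lF scalerDr !scalerA mulrC.
Qed.

Lemma lin_tlift (A B : falgType k) (V : lmodType k) (F : A -> B -> V)
    (f : X -> (A ⊗ B)%type) :
  linear f -> linear (fun x => tlift F (f x)).
Proof.
move=> lf c u v; rewrite /tlift lf scaler_sumr -big_split; apply: eq_bigr => i _.
rewrite scaler_sumr -big_split; apply: eq_bigr => j _.
by rewrite /= !mxE scalerDl scalerA.
Qed.

End LinearClosure.

(* Solves goals [linear (fun x => E)] and [bilin f] when [E] is multilinear. *)
Ltac lin1 :=
  match goal with
  | |- forall _, _ => intro
  | |- _ => first
    [ exact: lin_id | exact: linearP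
    | match goal with l : forall _, _ |- _ => exact: l end
    | apply: lin_tlift_fun => ? ? | apply: lin_tlift
    | apply: lin_ptensl | apply: lin_ptensr
    | apply: lin_mull | apply: lin_mulr
    | apply: lin_scaler | apply: lin_scalel
    | apply: lin_app ]
  end.

Section TensorTheory.
Variable k : fieldType.
Implicit Types A B C : falgType k.
Implicit Types V W : lmodType k.

Lemma tlift_post A B V W (g : V -> W) (f : A -> B -> V) t :
  linear g -> g (tlift f t) = tlift (fun a b => g (f a b)) t.
Proof.
move=> lg; pose gM := GRing.isLinear.Build _ _ _ _ g lg.
pose G : {linear V -> W} := HB.pack g gM.
rewrite -[g]/(G : V -> W) /tlift linear_sum; apply: eq_bigr => i _.
by rewrite linear_sum; apply: eq_bigr => j _; rewrite linearZ.
Qed.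

Lemma linZ V W (g : V -> W) c v : linear g -> g (c *: v) = c *: g v.
Proof.
move=> lg; pose gM := GRing.isLinear.Build _ _ _ _ g lg.
by pose G : {linear V -> W} := HB.pack g gM; apply: (linearZ_LR G).
Qed.

Lemma coord_ptens A B (i : 'I_(\dim {:A})) (j : 'I_(\dim {:B})) :
  (vbasis {:A})`_i ⊗ (vbasis {:B})`_j = delta_mx i j :> (A ⊗ B)%type.
Proof.
apply/matrixP => i' j'; rewrite !mxE !coord_free ?(basis_free (vbasisP _)) //.
by rewrite -natrM mulnb (eq_sym i') (eq_sym j').
Qed.

Lemma tens_decomp A B (t : (A ⊗ B)%type) : tlift (@ptens k A B) t = t.
Proof.
rewrite [RHS]matrix_sum_delta; apply: eq_bigr => i _; apply: eq_bigr => j _.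
by rewrite coord_ptens.
Qed.

Lemma eq_tlift A B V (f g : A -> B -> V) t :
  (forall a b, f a b = g a b) -> tlift f t = tlift g t.
Proof. by move=> fg; apply: eq_bigr => i _; apply: eq_bigr => j _; rewrite fg. Qed.

Lemma tens_ext A B V (f g : (A ⊗ B)%type -> V) :
    linear f -> linear g -> (forall a b, f (a ⊗ b) = g (a ⊗ b)) ->
  forall t, f t = g t.
Proof.
move=> lf lg fg t; rewrite -[t]tens_decomp !tlift_post //; exact: eq_tlift.
Qed.

Lemma tliftE A B V (f : A -> B -> V) a b : bilin f -> tlift f (a ⊗ b) = f a b.
Proof.
case=> lf1 lf2.
pose f1M := GRing.isLinear.Build _ _ _ _ (f^~ b) (lf1 b).
pose F1 : {linear A -> V} := HB.pack (f^~ b) f1M.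
transitivity (F1 a) => //.
rewrite [in RHS](coord_vbasis (memvf a)) linear_sum; apply: eq_bigr => i _.
pose f2M := GRing.isLinear.Build _ _ _ _ (f (vbasis {:A})`_i) (lf2 _).
pose F2 : {linear B -> V} := HB.pack (f (vbasis {:A})`_i) f2M.
rewrite linearZ /=; transitivity (coord (vbasis {:A}) i a *: F2 b) => //.
rewrite [in RHS](coord_vbasis (memvf b)) linear_sum scaler_sumr.
by apply: eq_bigr => j _; rewrite linearZ /= scalerA !mxE.
Qed.

Lemma exchange_tlift A B A' B' V (f : A -> B -> A' -> B' -> V) t u :
  tlift (fun a b => tlift (f a b) u) t =
  tlift (fun c d => tlift (fun a b => f a b c d) t) u.
Proof.
have tE A1 B1 (g : A1 -> B1 -> V) s : tlift g s = \sum_(p : 'I__ * 'I__)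
  s p.1 p.2 *: g (vbasis {:A1})`_p.1 (vbasis {:B1})`_p.2
  by rewrite /tlift pair_bigA.
rewrite !tE; under eq_bigr => p _ do rewrite tE scaler_sumr.
under [RHS]eq_bigr => p _ do rewrite tE scaler_sumr.
rewrite exchange_big /=; apply: eq_bigr => p _; apply: eq_bigr => q _.
by rewrite !scalerA mulrC.
Qed.

End TensorTheory.

Section TensorAlgebra.
Variables (k : fieldType) (A B : falgType k).
Implicit Types s t u : (A ⊗ B)%type.

Definition tens_one : (A ⊗ B)%type := 1 ⊗ 1.

(* The tensor product algebra; see [ptensM] for its value on pure tensors. *)
Definition tens_mul s t : (A ⊗ B)%type :=
  tlift (fun a b => tlift (fun a' b' => (a * a') ⊗ (b * b')) t) s.

Lemma tens_mull t : linear (tens_mul^~ t).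
Proof. by rewrite /tens_mul; repeat lin1. Qed.

Lemma tens_mulr s : linear (tens_mul s).
Proof. by rewrite /tens_mul; repeat lin1. Qed.

Lemma tens_mulE a b a' b' :
  tens_mul (a ⊗ b) (a' ⊗ b') = (a * a') ⊗ (b * b').
Proof. by rewrite /tens_mul !tliftE //; split; repeat lin1. Qed.

Lemma tens_mul1 : left_id tens_one tens_mul.
Proof.
apply: tens_ext => [||a b]; [exact: tens_mulr|exact: lin_id|].
by rewrite tens_mulE !mul1r.
Qed.

Lemma tens_mulr1 : right_id tens_one tens_mul.
Proof.
apply: tens_ext => [||a b]; [exact: tens_mull|exact: lin_id|].
by rewrite tens_mulE !mulr1.
Qed.

Lemma lin_comp (U V W : lmodType k) (g : V -> W) (f : U -> V) :
  linear g -> linear f -> linear (fun x => g (f x)).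
Proof. by move=> lg lf c u v; rewrite /= lf lg. Qed.

Lemma tens_mulA : associative tens_mul.
Proof.
move=> s t u; move: s; apply: tens_ext => [||a b].
- exact: tens_mull.
- exact: (lin_comp (tens_mull u) (tens_mull t)).
move: t; apply: tens_ext => [||a' b'].
- exact: (lin_comp (tens_mulr _) (tens_mull u)).
- exact: (lin_comp (tens_mull u) (tens_mulr _)).
move: u; apply: tens_ext => [||a'' b''].
- exact: (lin_comp (tens_mulr _) (tens_mulr _)).
- exact: tens_mulr.
by rewrite !tens_mulE !mulrA.
Qed.

Lemma tens_mulDl : left_distributive tens_mul +%R.
Proof. by move=> s t u; rewrite -[s]scale1r tens_mull !scale1r. Qed.

Lemma tens_mulDr : right_distributive tens_mul +%R.
Proof. by move=> u s t; rewrite -[s]scale1r tens_mulr !scale1r. Qed.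

Lemma tens_mul0 (s : (A ⊗ B)%type) : tens_mul 0 s = 0.
Proof. by have /= := tens_mull s (-1) 0 0; rewrite !scaleN1r !addNr. Qed.

Lemma tens_mul0r (s : (A ⊗ B)%type) : tens_mul s 0 = 0.
Proof. by have /= := tens_mulr s (-1) 0 0; rewrite !scaleN1r !addNr. Qed.

Lemma tens_one_neq0 : tens_one != 0.
Proof.
have nz (C : falgType k) : exists i, coord (vbasis {:C}) i (1 : C) != 0.
  apply/existsP; rewrite -negb_forall; apply/negP => /forallP c0.
  have /negP[] := oner_neq0 C; rewrite (coord_vbasis (memvf (1 : C))).
  by rewrite big1 // => i _; rewrite (eqP (c0 i)) scale0r.
have [[i ai] [j bj]] := (nz A, nz B).
apply/eqP => /matrixP/(_ i j)/eqP; rewrite !mxE mulf_eq0.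
by rewrite (negPf ai) (negPf bj).
Qed.

HB.instance Definition _ := GRing.Zmodule_isNzRing.Build (A ⊗ B)%type
  tens_mulA tens_mul1 tens_mulr1 tens_mulDl tens_mulDr tens_one_neq0.

Lemma tens_scaleAl c s t : c *: (s * t) = (c *: s) * t.
Proof.
by have /= := tens_mull t c s 0; rewrite !addr0 tens_mul0 addr0.
Qed.

HB.instance Definition _ :=
  GRing.Lmodule_isLalgebra.Build k (A ⊗ B)%type tens_scaleAl.

Lemma tens_scaleAr c s t : c *: (s * t) = s * (c *: t).
Proof.
by have /= := tens_mulr s c t 0; rewrite !addr0 tens_mul0r addr0.
Qed.

HB.instance Definition _ :=
  GRing.Lalgebra_isAlgebra.Build k (A ⊗ B)%type tens_scaleAr.
HB.instance Definition _ := Algebra_isFalgebra.Build k (A ⊗ B)%type.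

End TensorAlgebra.

Section TensorMaps.
Variable k : fieldType.
Implicit Types A B C : falgType k.

Definition tmap A B A' B' (f : A -> A') (g : B -> B') :
    (A ⊗ B)%type -> (A' ⊗ B')%type :=
  tlift (fun a b => f a ⊗ g b).

Definition tassoc A B C : (A ⊗ B ⊗ C)%type -> (A ⊗ (B ⊗ C))%type :=
  tlift (fun ab c => tlift (fun a b => a ⊗ (b ⊗ c)) ab).

Definition tswap A B : (A ⊗ B)%type -> (B ⊗ A)%type :=
  tlift (fun a b => b ⊗ a).

Lemma ptensM A B (a a' : A) (b b' : B) :
  (a ⊗ b) * (a' ⊗ b') = (a * a') ⊗ (b * b').
Proof. exact: tens_mulE. Qed.

Lemma ptens1 A B : (1 : A) ⊗ (1 : B) = 1.
Proof. by []. Qed.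

Lemma tliftM A B C (f : A -> B -> C) s t :
    bilin f -> (forall a b a' b', f (a * a') (b * b') = f a b * f a' b') ->
  tlift f (s * t) = tlift f s * tlift f t.
Proof.
move=> bf fM; move: s; apply: tens_ext => [||a b]; try by repeat lin1.
move: t; apply: tens_ext => [||a' b']; try by repeat lin1.
by rewrite ptensM !tliftE // fM.
Qed.

Lemma tlift1 A B C (f : A -> B -> C) :
  bilin f -> tlift f 1 = f 1 1.
Proof. by move=> bf; rewrite -ptens1 tliftE. Qed.

Section Tmap.
Variables (A B A' B' : falgType k).
Variables (f : {lrmorphism A -> A'}) (g : {lrmorphism B -> B'}).

Lemma tmapE a b : tmap f g (a ⊗ b) = f a ⊗ g b.
Proof. by rewrite /tmap tliftE //; split; repeat lin1. Qed.

Lemma tmapM s t : tmap f g (s * t) = tmap f g s * tmap f g t.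
Proof.
apply: tliftM => [|a b a' b']; first by split; repeat lin1.
by rewrite !rmorphM ptensM.
Qed.

Lemma tmap1 : tmap f g 1 = 1.
Proof.
by rewrite /tmap tlift1 ?rmorph1 //; split; repeat lin1.
Qed.
End Tmap.

Lemma tassocE A B C (a : A) (b : B) (c : C) :
  tassoc (a ⊗ b ⊗ c) = a ⊗ (b ⊗ c).
Proof. by rewrite /tassoc !tliftE //; split; repeat lin1. Qed.

Lemma tassoc_bilin A B C :
  bilin (fun (ab : (A ⊗ B)%type) (c : C) => tlift (fun a b => a ⊗ (b ⊗ c)) ab).
Proof. by split; repeat lin1. Qed.

Lemma tassoc_lin A B C : linear (@tassoc A B C).
Proof. by rewrite /tassoc; repeat lin1. Qed.

Lemma tassocM A B C (s t : (A ⊗ B ⊗ C)%type) :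
  tassoc (s * t) = tassoc s * tassoc t.
Proof.
apply: tliftM => [|u c v d]; first exact: tassoc_bilin.
move: u; apply: tens_ext => [||a b]; try by repeat lin1.
move: v; apply: tens_ext => [||a' b']; try by repeat lin1.
by rewrite ptensM !tliftE ?ptensM //; split; repeat lin1.
Qed.

Lemma tassoc1 A B C : tassoc (1 : (A ⊗ B ⊗ C)%type) = 1.
Proof. by rewrite -ptens1 -ptens1 tassocE. Qed.

End TensorMaps.

(* Finite dimensionality is part of [falgType]. *)
Record hopfAlgebra (k : fieldType) := HopfAlgebra {
  hopf_sort :> falgType k;
  comul : {lrmorphism hopf_sort -> (hopf_sort ⊗ hopf_sort)%type};
  counit : {lrmorphism hopf_sort -> k | *%R};
  antipode : {linear hopf_sort -> hopf_sort};
  comulA : forall h,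
    tassoc (tmap comul idfun (comul h)) = tmap idfun comul (comul h);
  counitl : forall h, tlift (fun a b => counit a *: b) (comul h) = h;
  counitr : forall h, tlift (fun a b => counit b *: a) (comul h) = h;
  antipodel : forall h, tlift (fun a b => antipode a * b) (comul h) = counit h *: 1;
  antipoder : forall h, tlift (fun a b => a * antipode b) (comul h) = counit h *: 1
}.

Arguments comul {k _}.
Arguments counit {k _}.
Arguments antipode {k _}.

Section HopfTheory.
Variables (k : fieldType) (H : hopfAlgebra k).
Local Notation "'Δ'" := (@comul k H).
Local Notation ε := (@counit k H).
Local Notation S := (@antipode k H).
Implicit Types (h x y : H) (s t : (H ⊗ H)%type).

Lemma coassoc (V : lmodType k) (F : H -> H -> H -> V) h :
    (forall b c, linear (fun a => F a b c)) ->
    (forall a c, linear (fun b => F a b c)) ->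
    (forall a b, linear (fun c => F a b c)) ->
  tlift (fun a b => tlift (fun a1 a2 => F a1 a2 b) (Δ a)) (Δ h) =
  tlift (fun a b => tlift (F a) (Δ b)) (Δ h).
Proof.
move=> l1 l2 l3.
pose L := tlift (fun a => @tlift k H H V (F a)).
have lL : linear L by rewrite /L; repeat lin1.
have bL a b c : L (a ⊗ (b ⊗ c)) = F a b c.
  by rewrite /L !tliftE //; split; repeat lin1.
have := congr1 L (comulA h); rewrite /tmap [in RHS](tlift_post _ _ lL).
move=> E; transitivity (L (tassoc (tlift (fun a b => Δ a ⊗ b) (Δ h)))).
  rewrite (tlift_post _ _ (@tassoc_lin k H H H)) (tlift_post _ _ lL).
  apply: eq_tlift => a b; rewrite /tassoc tliftE; last exact: tassoc_bilin.
  by rewrite (tlift_post _ _ lL); apply: eq_tlift => a1 a2; rewrite bL.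
apply: (etrans E); apply: eq_tlift => a b; rewrite /L tliftE //.
by split; repeat lin1.
Qed.

Lemma antipode1 : S 1 = 1.
Proof.
have := antipodel (1 : H); rewrite !rmorph1 scale1r tlift1 ?mulr1 //.
by split; repeat lin1.
Qed.

Lemma counitl_lin (V : lmodType k) (g : H -> V) h :
  linear g -> tlift (fun a b => counit a *: g b) (Δ h) = g h.
Proof.
move=> lg; rewrite -[in RHS](counitl h) (tlift_post _ _ lg).
by apply: eq_tlift => a b; rewrite (linZ _ _ lg).
Qed.

Lemma counitr_lin (V : lmodType k) (g : H -> V) h :
  linear g -> tlift (fun a b => counit b *: g a) (Δ h) = g h.
Proof.
move=> lg; rewrite -[in RHS](counitr h) (tlift_post _ _ lg).
by apply: eq_tlift => a b; rewrite (linZ _ _ lg).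
Qed.

(* The two bracketings of [S(x_1 y_1) x_2 y_2 S(y_3) S(x_3)] give [S(xy)] and
   [S(y) S(x)]. *)
Lemma antipodeM x y : S (x * y) = S y * S x.
Proof.
pose F x1 u v y1 p q := S (x1 * y1) * (u * (p * S q) * S v).
have lF1 x1 u v p q : linear (fun y1 => F x1 u v y1 p q) by rewrite /F; repeat lin1.
have lF2 x1 u v y1 q : linear (fun p => F x1 u v y1 p q) by rewrite /F; repeat lin1.
have lF3 x1 u v y1 p : linear (fun q => F x1 u v y1 p q) by rewrite /F; repeat lin1.
have lF4 u v y1 p q : linear (fun x1 => F x1 u v y1 p q) by rewrite /F; repeat lin1.
have lF5 x1 v y1 p q : linear (fun u => F x1 u v y1 p q) by rewrite /F; repeat lin1.
have lF6 x1 u y1 p q : linear (fun v => F x1 u v y1 p q) by rewrite /F; repeat lin1.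
pose G x1 u v := tlift (fun y1 y2 => tlift (F x1 u v y1) (Δ y2)) (Δ y).
have Gl x1 u v : G x1 u v =
    tlift (fun b q => tlift (fun y1 p => F x1 u v y1 p q) (Δ b)) (Δ y).
  by rewrite [RHS]coassoc.
have lG1 u v : linear (fun x1 => G x1 u v) by rewrite /G; repeat lin1.
have lG2 x1 v : linear (fun u => G x1 u v) by rewrite /G; repeat lin1.
have lG3 x1 u : linear (fun v => G x1 u v) by rewrite /G; repeat lin1.
have in_l s t v q :
    tlift (fun x1 u => tlift (fun y1 p => F x1 u v y1 p q) t) s =
    tlift (fun a b => S a * b) (s * t) * (S q * S v).
  move: s; apply: tens_ext => [||a1 a2]; try by repeat lin1.
  move: t; apply: tens_ext => [||b1 b2]; try by repeat lin1.
  rewrite ptensM !tliftE; try by split; repeat lin1.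
  by rewrite /F !mulrA.
have in_r x1 x2 y1 y2 :
    tlift (fun u v => tlift (F x1 u v y1) (Δ y2)) (Δ x2) =
    counit x2 *: (counit y2 *: S (x1 * y1)).
  transitivity (tlift (fun u v => counit y2 *: (S (x1 * y1) * (u * S v))) (Δ x2)).
    apply: eq_tlift => u v.
    rewrite -(tlift_post (fun p q => p * S q) _
                (g := fun z => S (x1 * y1) * (u * z * S v))); last by repeat lin1.
    by rewrite antipoder -scalerAr mulr1 -scalerAl -scalerAr.
  rewrite -(tlift_post (fun u v => u * S v) _
              (g := fun z => counit y2 *: (S (x1 * y1) * z))); last by repeat lin1.
  by rewrite antipoder -scalerAr mulr1 scalerA mulrC scalerA.
transitivity (tlift (fun x1 x2 => tlift (G x1) (Δ x2)) (Δ x)).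
  rewrite -(counitr_lin (g := fun z => S (z * y)) x); last by repeat lin1.
  apply: eq_tlift => x1 x2.
  rewrite -(counitr_lin (g := fun z => S (x1 * z)) y); last by repeat lin1.
  rewrite /G exchange_tlift (tlift_post _ _ (g := fun z => counit x2 *: z)).
    by apply: eq_tlift => y1 y2; rewrite in_r.
  by apply: lin_scaler; exact: lin_id.
rewrite -coassoc // -(counitl_lin (g := fun z => S y * S z) x); last first.
  by repeat lin1.
apply: eq_tlift => a v.
rewrite -(counitl_lin (g := fun z => S z * S v) y); last by repeat lin1.
rewrite (tlift_post _ _ (g := fun z => counit a *: z)); last first.
  by apply: lin_scaler; exact: lin_id.
under eq_tlift => x1 u do rewrite Gl.
rewrite exchange_tlift; apply: eq_tlift => b q.
by rewrite in_l -rmorphM antipodel rmorphM -scalerAl mul1r scalerA.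
Qed.
End HopfTheory.

Section Twist.
Variables (k : fieldType) (H : hopfAlgebra k).

Record is_twist (J : (H ⊗ H)%type) : Prop := IsTwist {
  twist_unit : J \is a GRing.unit;
  twist_cocycle :
    tassoc (tmap comul idfun J * (J ⊗ 1)) = tmap idfun comul J * (1 ⊗ J);
  twist_counitl : tlift (fun a b => counit a *: b) J = 1;
  twist_counitr : tlift (fun a b => counit b *: a) J = 1
}.

(* [S(J^(1)) J^(2)] *)
Definition twist_Q (J : (H ⊗ H)%type) : H := tlift (fun a b => antipode a * b) J.

Definition twist_comul (J : (H ⊗ H)%type) (h : H) : (H ⊗ H)%type :=
  J^-1 * comul h * J.

Definition twist_antipode (J : (H ⊗ H)%type) (h : H) : H :=
  (twist_Q J)^-1 * antipode h * twist_Q J.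

Section TwistedHopf.
Variables (J : (H ⊗ H)%type) (twJ : is_twist J).
Let uJ := twist_unit twJ.
Local Notation "'Δ'" := (@comul k H).
Local Notation ε := (@counit k H).
Local Notation S := (@antipode k H).
Local Notation K := (J^-1).
Local Notation Q := (twist_Q J).

Lemma lin_twist_comul : linear (twist_comul J).
Proof. by rewrite /twist_comul; repeat lin1. Qed.

Lemma lin_twist_antipode : linear (twist_antipode J).
Proof. by rewrite /twist_antipode; repeat lin1. Qed.

Lemma twist_comul_monoid : monoid_morphism (twist_comul J).
Proof.
split=> [|x y]; first by rewrite /twist_comul rmorph1 mulr1 mulVr.
by rewrite /twist_comul rmorphM !mulrA (mulrK uJ).
Qed.

HB.instance Definition _ :=
  GRing.isLinear.Build k H (H ⊗ H)%type _ (twist_comul J) lin_twist_comul.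
HB.instance Definition _ :=
  GRing.isMonoidMorphism.Build H (H ⊗ H)%type (twist_comul J) twist_comul_monoid.
HB.instance Definition _ :=
  GRing.isLinear.Build k H H _ (twist_antipode J) lin_twist_antipode.

Lemma twist_comulA h :
  tassoc (tmap (twist_comul J) idfun (twist_comul J h)) =
  tmap idfun (twist_comul J) (twist_comul J h).
Proof.
pose I : {lrmorphism H -> H} := idfun.
have tl t : tmap (twist_comul J) idfun t = (K ⊗ 1) * tmap Δ I t * (J ⊗ 1).
  move: t; apply: tens_ext => [||a b]; try by rewrite /tmap; repeat lin1.
  by rewrite (tmapE _ I) (tmapE Δ I) !ptensM mul1r mulr1.
have tr t : tmap idfun (twist_comul J) t = (1 ⊗ K) * tmap I Δ t * (1 ⊗ J).
  move: t; apply: tens_ext => [||a b]; try by rewrite /tmap; repeat lin1.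
  by rewrite (tmapE I) (tmapE I Δ) !ptensM mul1r mulr1.
have JK1 : (J ⊗ 1) * (K ⊗ 1) = 1 :> (H ⊗ H ⊗ H)%type.
  by rewrite ptensM mulrV // mulr1 ptens1.
have KJ1 : (K ⊗ 1) * (J ⊗ 1) = 1 :> (H ⊗ H ⊗ H)%type.
  by rewrite ptensM mulVr // mulr1 ptens1.
have JK2 : (1 ⊗ J) * (1 ⊗ K) = 1 :> (H ⊗ (H ⊗ H))%type.
  by rewrite ptensM mulrV // mulr1 ptens1.
have KJ2 : (1 ⊗ K) * (1 ⊗ J) = 1 :> (H ⊗ (H ⊗ H))%type.
  by rewrite ptensM mulVr // mulr1 ptens1.
pose X : (H ⊗ (H ⊗ H))%type := tassoc (tmap Δ I J * (J ⊗ 1)).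
pose X' : (H ⊗ (H ⊗ H))%type := tassoc ((K ⊗ 1) * tmap Δ I K).
pose Y : (H ⊗ (H ⊗ H))%type := tmap I Δ J * (1 ⊗ J).
pose Y' : (H ⊗ (H ⊗ H))%type := (1 ⊗ K) * tmap I Δ K.
have XX' : X * X' = 1.
  rewrite /X /X' -tassocM mulrA -(mulrA (tmap _ _ J)) JK1 mulr1.
  by rewrite -tmapM mulrV // tmap1 tassoc1.
have Y'Y : Y' * Y = 1.
  rewrite /Y /Y' mulrA -(mulrA (1 ⊗ K)) -tmapM mulVr // tmap1 mulr1.
  exact: KJ2.
have XY : X = Y by exact: twist_cocycle.
have X'Y' : X' = Y' by rewrite -[X']mul1r -Y'Y -XY -mulrA XX' mulr1.
rewrite tl tr /twist_comul !tmapM.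
transitivity (X' * tassoc (tmap Δ I (Δ h)) * X).
  by rewrite /X /X' -!tassocM !mulrA.
by rewrite X'Y' XY /Y /Y' (comulA h : _ = tmap I Δ _) !mulrA.
Qed.

Lemma tlift_counitlM s t :
  tlift (fun a b : H => ε a *: b) (s * t) =
  tlift (fun a b : H => ε a *: b) s * tlift (fun a b : H => ε a *: b) t.
Proof.
apply: tliftM => [|a b a' b']; first by split; repeat lin1.
by rewrite rmorphM -scalerA -scalerAl -scalerAr.
Qed.

Lemma tlift_counitrM s t :
  tlift (fun a b : H => ε b *: a) (s * t) =
  tlift (fun a b : H => ε b *: a) s * tlift (fun a b : H => ε b *: a) t.
Proof.
apply: tliftM => [|a b a' b']; first by split; repeat lin1.
by rewrite rmorphM -scalerA -scalerAl -scalerAr.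
Qed.

Lemma twistV_counitl : tlift (fun a b : H => ε a *: b) K = 1.
Proof.
rewrite -[LHS]mulr1 -[X in _ * X](twist_counitl twJ) -tlift_counitlM mulVr //.
by rewrite tlift1 ?rmorph1 ?scale1r //; split; repeat lin1.
Qed.

Lemma twistV_counitr : tlift (fun a b : H => ε b *: a) K = 1.
Proof.
rewrite -[LHS]mulr1 -[X in _ * X](twist_counitr twJ) -tlift_counitrM mulVr //.
by rewrite tlift1 ?rmorph1 ?scale1r //; split; repeat lin1.
Qed.

Lemma twist_comul_counitl h :
  tlift (fun a b : H => ε a *: b) (twist_comul J h) = h.
Proof.
rewrite !tlift_counitlM twistV_counitl counitl.
by rewrite (twist_counitl twJ) mul1r mulr1.
Qed.

Lemma twist_comul_counitr h :
  tlift (fun a b : H => ε b *: a) (twist_comul J h) = h.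
Proof.
rewrite !tlift_counitrM twistV_counitr counitr.
by rewrite (twist_counitr twJ) mul1r mulr1.
Qed.

(* [S(J^(1)) J^(2)] is right invertible, with inverse [K^(1) S(K^(2))] for
   [K := J^-1]; its being a unit then follows from finite dimensionality. *)
Definition twist_P : H := tlift (fun a b => a * S b) K.

Lemma twist_QP : Q * twist_P = 1.
Proof.
pose I : {lrmorphism H -> H} := idfun.
pose Psi := tlift (fun (x : H) (yz : (H ⊗ H)%type) =>
  S x * tlift (fun y z => y * S z) yz).
have lPsi : linear Psi by rewrite /Psi; repeat lin1.
have lA := @tassoc_lin k H H H.
have PsiE a b c : Psi (a ⊗ (b ⊗ c)) = S a * (b * S c).
  by rewrite /Psi !tliftE //; split; repeat lin1.
have lhs s t : Psi (tassoc (s ⊗ 1) * (1 ⊗ t)) =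
    tlift (fun a b => S a * b) s * tlift (fun a b => a * S b) t.
  move: s; apply: tens_ext => [||a b].
  - by apply: lin_comp lPsi _; apply: lin_mull; apply: lin_comp lA _; repeat lin1.
  - by repeat lin1.
  move: t; apply: tens_ext => [||c d].
  - by apply: lin_comp lPsi _; repeat lin1.
  - by repeat lin1.
  rewrite tassocE !ptensM mul1r mulr1 PsiE !tliftE; try by split; repeat lin1.
  by rewrite !mulrA.
have mid u v b c : Psi (tassoc (u ⊗ b) * (c ⊗ v)) =
    S c * (tlift (fun a b => S a * b) u * (tlift (fun a b => a * S b) v * S b)).
  move: u; apply: tens_ext => [||a1 a2].
  - by apply: lin_comp lPsi _; apply: lin_mull; apply: lin_comp lA _; repeat lin1.
  - by repeat lin1.
  move: v; apply: tens_ext => [||d1 d2].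
  - by apply: lin_comp lPsi _; repeat lin1.
  - by repeat lin1.
  rewrite tassocE !ptensM PsiE !tliftE; try by split; repeat lin1.
  by rewrite !antipodeM !mulrA.
have rhs s t : Psi (tassoc (tmap Δ I s) * tmap I Δ t) =
    S (tlift (fun a b => ε b *: a) t) * S (tlift (fun a b => ε a *: b) s).
  move: s; apply: tens_ext => [||a b].
  - apply: lin_comp lPsi _; apply: lin_mull; apply: lin_comp lA _.
    by rewrite /tmap; repeat lin1.
  - by repeat lin1.
  move: t; apply: tens_ext => [||c d].
  - by apply: lin_comp lPsi _; rewrite /tmap; repeat lin1.
  - by repeat lin1.
  rewrite !tmapE mid antipodel antipoder !tliftE; try by split; repeat lin1.
  by rewrite !linearZ /= -!scalerAl !mul1r -!scalerAr !scalerA [ε d * _]mulrC.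
rewrite /twist_Q /twist_P -lhs.
have -> : tassoc (J ⊗ 1) * (1 ⊗ K) = tassoc (tmap Δ I K) * tmap I Δ J.
  have E := twist_cocycle twJ; rewrite tassocM in E.
  have -> : tassoc (J ⊗ 1) = tassoc (tmap Δ I K) * (tmap I Δ J * (1 ⊗ J)).
    rewrite -[X in _ * X]E mulrA -tassocM -(tmapM Δ I) mulVr // tmap1 tassoc1.
    by rewrite mul1r.
  rewrite -!mulrA; congr (_ * _); rewrite -[RHS]mulr1; congr (_ * _).
  by rewrite ptensM mulrV // mulr1 ptens1.
by rewrite rhs (twist_counitr twJ) twistV_counitl antipode1 mulr1.
Qed.

Lemma twist_Q_unit : Q \is a GRing.unit.
Proof.
have ker0 : lker (amull twist_P) == 0%VS.
  apply/lker0P => u v; rewrite !lfunE /= => /(congr1 ( *%R Q)).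
  by rewrite !mulrA twist_QP !mul1r.
have [v Pv] : exists v, twist_P * v = 1.
  by exists ((amull twist_P)^-1%VF 1); have := lker0_lfunVK ker0 1; rewrite lfunE.
have vQ : v = Q by rewrite -[v]mul1r -twist_QP -mulrA Pv mulr1.
by apply/unitrP; exists twist_P; rewrite twist_QP -vQ Pv.
Qed.

Lemma twist_antipodel h :
  tlift (fun a b => twist_antipode J a * b) (twist_comul J h) = ε h *: 1.
Proof.
pose L x t := tlift (fun a b : H => S a * x * b) t.
have LM x s t : L x (s * t) = L (L x s) t.
  rewrite /L; move: t; apply: tens_ext => [||c d]; try by repeat lin1.
  move: s; apply: tens_ext => [||a b]; try by repeat lin1.
  rewrite ptensM !tliftE; try by split; repeat lin1.
  by rewrite antipodeM !mulrA.
have L1 t : L 1 t = tlift (fun a b => S a * b) t.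
  by apply: eq_tlift => a b; rewrite mulr1.
have LZ c t : L (c *: 1) t = c *: L 1 t.
  by rewrite /L (tlift_post _ _ (g := fun z => c *: z));
     [apply: eq_tlift => a b; rewrite -scalerAr -scalerAl
     | apply: lin_scaler; exact: lin_id].
have LQK : L Q K = 1.
  rewrite /twist_Q -L1 -LM mulrV // /L tlift1; last by split; repeat lin1.
  by rewrite antipode1 !mulr1.
transitivity (Q^-1 * L Q (twist_comul J h)).
  rewrite (tlift_post _ _ (g := fun z => Q^-1 * z)); last by repeat lin1.
  by apply: eq_tlift => a b; rewrite /twist_antipode !mulrA.
rewrite /twist_comul !LM LQK L1 antipodel LZ L1 -/Q -scalerAr mulVr //.
exact: twist_Q_unit.
Qed.

Lemma twist_antipoder h :
  tlift (fun a b => a * twist_antipode J b) (twist_comul J h) = ε h *: 1.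
Proof.
pose R x t := tlift (fun a b : H => a * x * S b) t.
have RM x s t : R x (s * t) = R (R x t) s.
  rewrite /R; move: t; apply: tens_ext => [||c d]; try by repeat lin1.
  move: s; apply: tens_ext => [||a b]; try by repeat lin1.
  rewrite ptensM !tliftE; try by split; repeat lin1.
  by rewrite antipodeM !mulrA.
have R1 t : R 1 t = tlift (fun a b => a * S b) t.
  by apply: eq_tlift => a b; rewrite mulr1.
have RZ c t : R (c *: 1) t = c *: R 1 t.
  by rewrite /R (tlift_post _ _ (g := fun z => c *: z));
     [apply: eq_tlift => a b; rewrite -scalerAr -scalerAl
     | apply: lin_scaler; exact: lin_id].
have QV : Q^-1 = twist_P by rewrite -[LHS]mulr1 -twist_QP mulKr // twist_Q_unit.
have RPJ : R Q^-1 J = 1.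
  rewrite QV /twist_P -R1 -RM mulrV // /R tlift1; last by split; repeat lin1.
  by rewrite antipode1 !mulr1.
transitivity (R Q^-1 (twist_comul J h) * Q).
  rewrite (tlift_post _ _ (g := fun z => z * Q)); last by repeat lin1.
  by apply: eq_tlift => a b; rewrite /twist_antipode !mulrA.
rewrite /twist_comul !RM RPJ R1 antipoder RZ R1 -/twist_P -QV -scalerAl mulVr //.
exact: twist_Q_unit.
Qed.

(* [H^J]: its carrier is the algebra [H] itself. *)
Definition twistedHopf : hopfAlgebra k :=
  HopfAlgebra (comul := twist_comul J) (counit := counit)
    (antipode := twist_antipode J) twist_comulA twist_comul_counitl
    twist_comul_counitr twist_antipodel twist_antipoder.

End TwistedHopf.
End Twist.

Section Quasitriangular.
Variables (k : fieldType) (H : hopfAlgebra k).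

(* All three live in [H ⊗ (H ⊗ H)]. *)
Definition R12 (r : (H ⊗ H)%type) : (H ⊗ (H ⊗ H))%type :=
  tmap idfun (fun b => b ⊗ 1) r.
Definition R13 (r : (H ⊗ H)%type) : (H ⊗ (H ⊗ H))%type :=
  tmap idfun (fun b => 1 ⊗ b) r.
Definition R23 (r : (H ⊗ H)%type) : (H ⊗ (H ⊗ H))%type := 1 ⊗ r.

(* [Δ^op = r Δ r^-1], [(Δ ⊗ id)(r) = r_13 r_23], [(id ⊗ Δ)(r) = r_13 r_12] *)
Record universal_R (r : (H ⊗ H)%type) : Prop := UniversalR {
  R_unit : r \is a GRing.unit;
  R_intertwines : forall h : H, tswap (comul h) = r * comul h * r^-1;
  R_hexagonl : tassoc (tmap comul idfun r) = R13 r * R23 r;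
  R_hexagonr : tmap idfun comul r = R13 r * R12 r
}.

Definition quasitriangular : Prop := exists r, universal_R r.

End Quasitriangular.

Section Cosemisimple.
Variables (k : fieldType) (H : hopfAlgebra k).

(* The image of [D ⊗ E] in [H ⊗ H]. *)
Definition tensv (D E : {vspace H}) : {vspace (H ⊗ H)%type} :=
  <<[seq a ⊗ b | a <- vbasis D, b <- vbasis E]>>%VS.

Definition subcoalgebra (D : {vspace H}) : Prop :=
  forall d, d \in D -> comul d \in tensv D D.

Definition simple_subcoalgebra (D : {vspace H}) : Prop :=
  [/\ subcoalgebra D, D != 0%VS &
      forall E : {vspace H}, subcoalgebra E -> (E <= D)%VS -> E = 0%VS \/ E = D].

(* [H] is the direct sum of simple subcoalgebras. *)
Definition cosemisimple : Prop :=
  exists (n : nat) (D : 'I_n -> {vspace H}),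
    [/\ forall i, simple_subcoalgebra (D i),
        directv (\sum_(i < n) D i) & (\sum_(i < n) D i)%VS = fullv].

End Cosemisimple.

Arguments quasitriangular {k} H.
Arguments cosemisimple {k} H.

(* Main.v *)
From HB Require Import structures.
Require Import Defs.
From mathcomp Require Import all_boot all_order all_algebra all_field.
From Stdlib Require Import Classical.

(** Cosemisimplicity is equivalent to the existence of a coseparability
    pairing, i.e. a functional [τ] on [H ⊗ H] with [τ (x_1 ⊗ x_2) = ε x] and
    [x_1 τ (x_2 ⊗ y) = τ (x ⊗ y_1) y_2].

    - If such a [τ] exists, averaging a linear projection onto a subcoalgebra
      on both sides makes it bicolinear, so every subcoalgebra has a
      complementary subcoalgebra and [H] is a direct sum of simple ones
      ([subcoalgebra_complement], [coseparable_cosemisimple]).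
    - If [H] is cosemisimple, the line [k 1] is one of the simple summands;
      the projection onto it is a two-sided integral [λ] with [λ 1 = 1]
      ([cosemisimple_haar]), and [τ (x ⊗ y) = λ (x S(y))] is a coseparability
      pairing ([haar_coseparability]).

    For [H^J] the natural candidate is [τ_J t = τ (J t J^-1)].  The counit
    condition is immediate.  In the triple tensor power the twist equation turns
    [J_23 J_12^-1] into [(id ⊗ Δ)(J^-1) (Δ ⊗ id)(J)], so the shift condition for
    [τ_J] reduces to the one for [τ] as soon as
    [τ (Δ a * t * Δ b) = ε a ε b τ t] ([twist_coseparability]).  This invariance
    follows from the trace property [λ (x y) = λ (y S^2(x))] ([haar_trace]),
    which is where the R-matrix enters.

    The form [λ (x y)] is nondegenerate ([haar_nondeg]), hence has a Nakayama
    automorphism [σ], and the integral property gives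
    [σ x = S^2(x_1) α(x_2)] for the character [α = ε σ]
    ([nakayama_antipode]).  One must show [α = ε], i.e. that [H] is unimodular.
    Write [r] for the R-matrix and [ℓ = (λ ⊗ id)(r)].  By the hexagon equations
    [ℓ] is a two-sided integral, with [ε ℓ = 1], of the Hopf subalgebra spanned
    by the second legs of [r].  A trace computation shows [λ ℓ != 0]
    ([haar_R_haar_neq0]); comparing [λ (b ℓ)] with [λ (ℓ σ(b))] then shows that
    [α] is trivial on that subalgebra, i.e. [(id ⊗ α)(r) = 1] ([R_modular]).
    Applying [id ⊗ α] to [Δ^op r = r Δ] makes [α] central for the convolution
    product ([modular_central]).  So [σ x = α(x_1) S^2(x_2)] too, and
    [ε h = λ (h_1 S(h_2)) = λ (S(h_2) σ(h_1)) = α(h_1) λ (S(S(h_2) h_3)) = α h]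
    ([modular_trivial]).

    Quasitriangularity is Drinfeld's formula: [J_21^-1 r J] is an R-matrix for
    [H^J]; both hexagons follow from those of [r], [Δ^op r = r Δ], and
    permuted forms of the twist equation ([twisted_universal_R]). *)

Set Implicit Arguments.
Unset Strict Implicit.
Unset Printing Implicit Defensive.

Import GRing.Theory.
Local Open Scope ring_scope.

(** * From coseparability to cosemisimplicity *)

Lemma tlift_mul (k : fieldType) (A B : falgType k) (V : lmodType k)
    (f : A -> B -> V) (s t : A ⊗ B) :
  bilin f ->
  tlift f (s * t) =
  tlift (fun a b => tlift (fun a' b' => f (a * a') (b * b')) t) s.
Proof.
move=> bf; have [l1 l2] := bf.
have l1' (X : lmodType k) (g : X -> A) b : linear g -> linear (fun x => f (g x) b).
  by move=> lg c u v; rewrite lg l1.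
have l2' (X : lmodType k) (g : X -> B) a : linear g -> linear (fun x => f a (g x)).
  by move=> lg c u v; rewrite lg l2.
move: s; apply: tens_ext => [||a b].
- by repeat lin1.
- by apply: lin_tlift; apply: lin_id.
move: t; apply: tens_ext => [||a' b']; try by repeat lin1.
rewrite ptensM tliftE // tliftE; last first.
  by split=> z; apply: lin_tlift_fun => u v; [apply: l1'|apply: l2']; repeat lin1.
by rewrite tliftE //; split=> z; [apply: l1'|apply: l2']; repeat lin1.
Qed.

Section SubspaceTensors.
Variables (k : fieldType) (H : hopfAlgebra k).
Implicit Types D E V : {vspace H}.

Lemma mem_tensv D E a b : a \in D -> b \in E -> a ⊗ b \in tensv D E.
Proof.
move=> Da Eb; rewrite (coord_vbasis Da) (coord_vbasis Eb).
have -> (x : 'I_(\dim D) -> k) (y : 'I_(\dim E) -> k) :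
    (\sum_i x i *: (vbasis D)`_i) ⊗ (\sum_j y j *: (vbasis E)`_j)
    = \sum_i \sum_j (x i * y j) *: ((vbasis D)`_i ⊗ (vbasis E)`_j) :> H ⊗ H.
  apply/matrixP => p q; rewrite mxE !linear_sum mulr_suml summxE.
  apply: eq_bigr => i _; rewrite mulr_sumr summxE; apply: eq_bigr => j _.
  by rewrite !mxE !linearZ /= mulrACA.
apply: memv_suml => i _; apply: memv_suml => j _; apply: memvZ.
by apply: memv_span; apply: allpairs_f; apply: mem_nth; rewrite size_tuple.
Qed.

Lemma tensv_ind D E (P : H ⊗ H -> Prop) :
    (forall c u v, P u -> P v -> P (c *: u + v)) -> P 0 ->
    (forall a b, a \in D -> b \in E -> P (a ⊗ b)) ->
  forall t, t \in tensv D E -> P t.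
Proof.
move=> PD P0 Pp t; rewrite /tensv; set s := (X in <<X>>%VS).
rewrite -[s]/(in_tuple s : seq _) => /coord_span->; apply: (big_ind P) => //.
  by move=> x y Px Py; rewrite -[x]scale1r; apply: PD.
move=> i _; rewrite -[_ *: _]addr0; apply: PD => //.
have: s`_i \in s by apply: mem_nth.
by move=> /allpairsP[[a b] /= [Da Eb ->]]; apply: Pp; apply: vbasis_mem.
Qed.

Lemma memv_tlift D E V (f : H -> H -> H) t :
    t \in tensv D E -> bilin f ->
    (forall a b, a \in D -> b \in E -> f a b \in V) ->
  tlift f t \in V.
Proof.
move=> Dt bf fV; move: t Dt; apply: tensv_ind => [c u v Pu Pv||a b Da Eb].
- by rewrite (lin_tlift f (@lin_id _ _)) memvD // memvZ.
- by rewrite /tlift big1 ?mem0v // => i _; rewrite big1 // => j _; rewrite mxE scale0r.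
- by rewrite tliftE //; apply: fV.
Qed.

Lemma tlift_memv V (f : H -> H -> H) t : (forall a b, f a b \in V) -> tlift f t \in V.
Proof. by move=> fV; do 2!apply: memv_suml => ? _; apply: memvZ. Qed.

Lemma eq_tlift_tensv D E (V : lmodType k) (f g : H -> H -> V) t :
    t \in tensv D E -> bilin f -> bilin g ->
    (forall a b, a \in D -> b \in E -> f a b = g a b) ->
  tlift f t = tlift g t.
Proof.
move=> Dt bf bg fg; move: t Dt; apply: tensv_ind => [c u v Pu Pv||a b Da Eb].
- by rewrite !(lin_tlift _ (@lin_id _ _)) Pu Pv.
- by rewrite /tlift; apply: eq_bigr => i _; apply: eq_bigr => j _; rewrite mxE !scale0r.
- by rewrite !tliftE //; apply: fg.
Qed.

End SubspaceTensors.

Section Coseparability.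
Variables (k : fieldType) (H : hopfAlgebra k).
Local Notation "'Δ'" := (@comul k H).
Local Notation ε := (@counit k H).

(** Dual to a separability idempotent: [x ⊗ y => x_1 τ (x_2 ⊗ y)] is a bicolinear
    retraction of [Δ]. *)
Record coseparability (τ : {scalar (H ⊗ H)%type}) : Prop := Coseparability {
  cosep_counit : forall x : H, τ (Δ x) = ε x;
  cosep_shift : forall x y : H,
    tlift (fun a b => τ (b ⊗ y) *: a) (Δ x) =
    tlift (fun a b => τ (x ⊗ a) *: b) (Δ y)
}.

Section Maschke.
Variables (τ : {scalar (H ⊗ H)%type}) (cosep : coseparability τ).
Variables (D : {vspace H}) (sD : subcoalgebra D).

Let π : {linear H -> H} := projv D.
Let shift := cosep_shift cosep.

Let piD x : π x \in D. Proof. exact: memv_proj. Qed.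
Let pi_id d : d \in D -> π d = d. Proof. exact: projv_id. Qed.

(* [p x = x_1 τ (x_2 ⊗ π x_3)] averages [π] on the left. By the shift property
   it is also [τ (x_1 ⊗ (π x_2)_1) (π x_2)_2], which lies in [D]; the first form
   makes it left colinear. *)
Let p x := tlift (fun a b => τ (tlift (fun c d => c ⊗ π d) (Δ b)) *: a) (Δ x).
Let lin_p : linear p. Proof. by rewrite /p; repeat lin1. Qed.

Let pE x : p x = tlift (fun a b => tlift (fun c d => τ (a ⊗ c) *: d) (Δ (π b))) (Δ x).
Proof.
have bf b : bilin (fun a c => τ (c ⊗ π b) *: a) by split; repeat lin1.
transitivity (tlift (fun a b => tlift (fun c d => τ (d ⊗ π b) *: c) (Δ a)) (Δ x)).
  rewrite coassoc; try by repeat lin1.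
  apply: eq_tlift => a b; rewrite -[LHS]/((fun t => τ t *: a) _) tlift_post //.
  by repeat lin1.
by apply: eq_tlift => a b; rewrite shift.
Qed.

Let pD x : p x \in D.
Proof.
rewrite pE; apply: tlift_memv => a0 b0; apply: (memv_tlift (sD (piD _))); first by split; repeat lin1.
by move=> a b _ Db; apply: memvZ.
Qed.

Let p_id d : d \in D -> p d = d.
Proof.
move=> Dd; rewrite -[RHS]counitr /p; apply: (eq_tlift_tensv (sD Dd)).
- by split; repeat lin1.
- by split; repeat lin1.
move=> a b _ Db; congr (_ *: _); rewrite -(cosep_counit cosep) -[in RHS](tens_decomp (Δ b)).
congr (τ _); apply: (eq_tlift_tensv (sD Db)); try by split; repeat lin1.
by move=> c d' _ Dd'; rewrite pi_id.
Qed.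

Let comul_p x : Δ (p x) = tlift (fun a b => a ⊗ p b) (Δ x).
Proof.
rewrite /p [LHS](tlift_post _ _ (g := Δ)); last by repeat lin1.
transitivity (tlift (fun a b => tlift (fun c d =>
   τ (tlift (fun c d => c ⊗ π d) (Δ b)) *: (c ⊗ d)) (Δ a)) (Δ x)).
  apply: eq_tlift => a b; rewrite linearZ /= -[in LHS](tens_decomp (Δ a)).
  by rewrite (tlift_post _ _ (g := fun z => _ *: z)) //; apply: lin_scaler; apply: lin_id.
rewrite coassoc; try by repeat lin1.
apply: eq_tlift => a b; rewrite (tlift_post _ _ (g := fun z => a ⊗ z)); last by repeat lin1.
by apply: eq_tlift => c d; rewrite (linZ (g := fun z => a ⊗ z)) //; repeat lin1.
Qed.

(* Averaging [p] on the right gives the bicolinear projection [q] onto [D]; it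
   is the action of a functional [e], central for the convolution product. *)
Let e x := τ (tlift (fun a b => p a ⊗ b) (Δ x)).
Let q x := tlift (fun a b => e b *: a) (Δ x).

Let lin_pf (X : lmodType k) (f : X -> H) : linear f -> linear (fun x => p (f x)).
Proof. by move=> lf c u v; rewrite lf lin_p. Qed.

Let lin_q : linear q.
Proof. by rewrite /q /e; do !(lin1 || apply: lin_pf). Qed.

Let q_mid x :
  q x = tlift (fun a b => tlift (fun c d => τ (d ⊗ b) *: c) (Δ (p a))) (Δ x).
Proof.
transitivity (tlift (fun a b => tlift (fun c d => τ (p c ⊗ d) *: a) (Δ b)) (Δ x)).
  apply: eq_tlift => a b; rewrite -[LHS]/((fun t => τ t *: a) _) tlift_post //.
  by repeat lin1.
rewrite -coassoc; try by do !(lin1 || apply: lin_pf).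
apply: eq_tlift => a b; rewrite comul_p [RHS]tlift_post; last by repeat lin1.
by apply: eq_tlift => c d; rewrite tliftE //; split; repeat lin1.
Qed.

Let qE x : q x = tlift (fun a b => e a *: b) (Δ x).
Proof.
rewrite q_mid.
transitivity (tlift (fun a b => tlift (fun c d => τ (p a ⊗ c) *: d) (Δ b)) (Δ x)).
  by apply: eq_tlift => a b; rewrite shift.
rewrite -coassoc; try by do !(lin1 || apply: lin_pf).
apply: eq_tlift => a b; symmetry.
rewrite -[LHS]/((fun t => τ t *: b) _) tlift_post //.
by do !(lin1 || apply: lin_pf).
Qed.

Let qD x : q x \in D.
Proof.
rewrite q_mid; apply: tlift_memv => a0 b0; apply: (memv_tlift (sD (pD _))); first by split; repeat lin1.
by move=> a b Da _; apply: memvZ.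
Qed.

Let q_id d : d \in D -> q d = d.
Proof.
move=> Dd; rewrite -[RHS]counitr /q; apply: (eq_tlift_tensv (sD Dd)).
- by rewrite /e; split; do !(lin1 || apply: lin_pf).
- by split; repeat lin1.
move=> a b _ Db; congr (_ *: _); rewrite -(cosep_counit cosep) -[in RHS](tens_decomp (Δ b)).
congr (τ _); apply: (eq_tlift_tensv (sD Db)).
- by split; do !(lin1 || apply: lin_pf).
- by split; repeat lin1.
by move=> c d' Dc _; rewrite p_id.
Qed.

Let lin_e (X : lmodType k) (V : lmodType k) (f : X -> H) (v : V) :
  linear f -> linear (fun x => e (f x) *: v).
Proof. by move=> lf; rewrite /e; do !(lin1 || apply: lin_pf). Qed.

Let comul_ql x : Δ (q x) = tlift (fun a b => q a ⊗ b) (Δ x).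
Proof.
rewrite qE [LHS](tlift_post _ _ (g := Δ)); last by repeat lin1.
transitivity (tlift (fun a b => tlift (fun c d => e a *: (c ⊗ d)) (Δ b)) (Δ x)).
  apply: eq_tlift => a b; rewrite linearZ /= -[in LHS](tens_decomp (Δ b)).
  by rewrite (tlift_post _ _ (g := fun z => _ *: z)) //; apply: lin_scaler; apply: lin_id.
rewrite -coassoc; try by do ?[lin1 | apply: lin_e].
apply: eq_tlift => a b; rewrite qE (tlift_post _ _ (g := fun z => z ⊗ b)); last by repeat lin1.
by apply: eq_tlift => c d; rewrite (linZ (g := fun z => z ⊗ b)) //; repeat lin1.
Qed.

Let comul_qr x : Δ (q x) = tlift (fun a b => a ⊗ q b) (Δ x).
Proof.
rewrite /q [LHS](tlift_post _ _ (g := Δ)); last by repeat lin1.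
transitivity (tlift (fun a b => tlift (fun c d => e b *: (c ⊗ d)) (Δ a)) (Δ x)).
  apply: eq_tlift => a b; rewrite linearZ /= -[in LHS](tens_decomp (Δ a)).
  by rewrite (tlift_post _ _ (g := fun z => _ *: z)) //; apply: lin_scaler; apply: lin_id.
rewrite coassoc; try by do ?[lin1 | apply: lin_e].
apply: eq_tlift => a b; rewrite (tlift_post _ _ (g := fun z => a ⊗ z)); last by repeat lin1.
by apply: eq_tlift => c d; rewrite (linZ (g := fun z => a ⊗ z)) //; repeat lin1.
Qed.

(** Maschke's theorem: [q] is an idempotent with image [D] and
    [Δ (q x) = q x_1 ⊗ x_2 = x_1 ⊗ q x_2], so [Δ] maps the part of [C]
    killed by [q] into its own tensor square. *)
Lemma subcoalgebra_complement (C : {vspace H}) :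
    subcoalgebra C -> (D <= C)%VS ->
  exists E : {vspace H},
    [/\ subcoalgebra E, (D :&: E)%VS = 0%VS & (D + E)%VS = C].
Proof.
move=> sC DC.
pose qM := GRing.isLinear.Build _ _ _ _ q lin_q.
pose Q : {linear H -> H} := HB.pack q qM.
have lin_qf (X : lmodType k) (f : X -> H) : linear f -> linear (fun x => q (f x)).
  by move=> lf c u v; rewrite lf lin_q.
exists (C :&: lker (linfun Q))%VS.
have kerE x : (x \in lker (linfun Q)) = (q x == 0) by rewrite memv_ker lfunE.
have rE x : x \in C -> x - q x \in (C :&: lker (linfun Q))%VS.
  move=> Cx; rewrite memv_cap kerE memvB //=; last by apply: (subvP DC).
  have -> : q (x - q x) = q x - q (q x) by apply: (raddfB Q).
  by rewrite (q_id (qD _)) subrr.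
split.
- move=> x; rewrite memv_cap kerE => /andP[Cx /eqP qx0].
  have ql0 : tlift (fun a b => q a ⊗ b) (Δ x) = 0 by rewrite -comul_ql qx0 linear0.
  have qr0 : tlift (fun a b => a ⊗ q b) (Δ x) = 0 by rewrite -comul_qr qx0 linear0.
  have qq0 : tlift (fun a b => q a ⊗ q b) (Δ x) = 0.
    have := congr1 (tlift (fun a b : H => a ⊗ q b)) ql0.
    rewrite [RHS]/tlift big1 => [|i _]; last first.
      by rewrite big1 // => j _; rewrite mxE scale0r.
    move=> <-; rewrite [RHS]tlift_post; last by do ?[lin1 | apply: lin_qf].
    by apply: eq_tlift => a b; rewrite tliftE //; split; do ?[lin1 | apply: lin_qf].
  (* On the kernel of [q] the projection [1 - q] fixes both legs of [Δ x]. *)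
  have -> : Δ x = tlift (fun a b => (a - q a) ⊗ (b - q b)) (Δ x).
    rewrite -[LHS]tens_decomp -[LHS]subr0 -[LHS]subr0 -[LHS]addr0.
    rewrite -{1}ql0 -{1}qr0 -{1}qq0 /tlift -!sumrB -big_split; apply: eq_bigr => i _ /=.
    rewrite -!sumrB -big_split; apply: eq_bigr => j _ /=.
    rewrite -!scalerBr -scalerDr; congr (_ *: _); apply/matrixP => i' j'.
    rewrite !mxE !linearB /=; set a := coord _ _ _; set b := coord _ _ _.
    set c := coord _ _ _; set d := coord _ _ _.
    by rewrite mulrBr !mulrBl opprB addrA [RHS]addrAC.
  move: (sC _ Cx); apply: (@tensv_ind _ H C C (fun t => tlift _ t \in _)).
  + by move=> c u v Pu Pv; rewrite (lin_tlift _ (@lin_id _ _)) memvD // memvZ.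
  + by rewrite /tlift big1 ?mem0v // => i _; rewrite big1 // => j _; rewrite mxE scale0r.
  move=> a b Ca Cb; rewrite tliftE; first by apply: mem_tensv; apply: rE.
  have l1 : linear (fun x => x - q x).
    move=> c u v; rewrite lin_q scalerBr opprD addrACA //.
  by split=> [b'|a']; [apply: (@lin_ptensl _ _ _ _ (fun x => x - q x))
                      |apply: (@lin_ptensr _ _ _ _ (fun x => x - q x))].
- apply/eqP; rewrite -subv0; apply/subvP => x; rewrite !memv_cap kerE memv0.
  by case/and3P=> Dx _; rewrite (q_id Dx).
- apply/eqP; rewrite eqEsubv subv_add DC capvSl /=; apply/subvP => x Cx.
  by rewrite -[x](subrK (q x)) addrC memv_add ?rE.
Qed.

End Maschke.

(** Split off proper subcoalgebras by induction on the dimension. Directness of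
    the sum is recorded as additivity of dimensions, which concatenation
    preserves. *)
Lemma coseparable_cosemisimple (τ : {scalar (H ⊗ H)%type}) :
  coseparability τ -> cosemisimple H.
Proof.
move=> cosep.
suff dec n (C : {vspace H}) : (\dim C <= n)%N -> subcoalgebra C ->
    exists s : seq {vspace H},
      [/\ forall i, (i < size s)%N -> simple_subcoalgebra (nth 0%VS s i),
          (\sum_(E <- s) \dim E)%N = \dim C & (\sum_(E <- s) E)%VS = C].
  have [|s [simp_s dim_s sum_s]] := dec _ {:H}%VS (leqnn _).
    by move=> x _; rewrite -[X in X \in _]tens_decomp /tlift;
       apply: memv_suml => i _; apply: memv_suml => j _;
       apply: memvZ; apply: mem_tensv; apply: memvf.
  have big_s (T : Type) (z : T) op (F : {vspace H} -> T) :
      \big[op/z]_(E <- s) F E = \big[op/z]_(i < size s) F (nth 0%VS s i).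
    by rewrite (big_nth 0%VS) big_mkord.
  have sumE : (\sum_(i < size s) nth 0 s i)%VS = fullv.
    by rewrite -(big_s _ _ _ (fun E => E)).
  exists (size s), (fun i => nth 0%VS s i); split=> // [i|]; first exact: simp_s.
  by rewrite directvE /= sumE -dim_s big_s.
elim: n C => [|n IHn] C dimC sC.
  exists [::]; rewrite !big_nil; move: dimC; rewrite leqn0 => /eqP dC.
  by split=> //; apply/eqP; rewrite eq_sym -dimv_eq0 dC.
have [->|nzC] := eqVneq C 0%VS.
  by exists [::]; rewrite !big_nil dimv0.
have [[E [sE EC nzE neqE]]|simpC] := classic (exists E : {vspace H},
    [/\ subcoalgebra E, (E <= C)%VS, E != 0%VS & E != C]).
  have [F [sF dEF sumEF]] := subcoalgebra_complement cosep sE sC EC.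
  have dim_sum : (\dim E + \dim F)%N = \dim C.
    by rewrite -dimv_sum_cap sumEF dEF dimv0 addn0.
  have dE0 : (0 < \dim E)%N by rewrite lt0n dimv_eq0.
  have dF0 : (0 < \dim F)%N.
    rewrite lt0n dimv_eq0; apply: contraNneq neqE => F0.
    by rewrite -sumEF F0 addv0.
  have [|s1 [simp1 dim1 sum1]] := IHn E _ sE.
    by rewrite -ltnS; apply: leq_trans dimC; rewrite -dim_sum -addn1 leq_add2l.
  have [|s2 [simp2 dim2 sum2]] := IHn F _ sF.
    by rewrite -ltnS; apply: leq_trans dimC; rewrite -dim_sum -add1n leq_add2r.
  exists (s1 ++ s2); rewrite !big_cat /= dim1 dim2 sum1 sum2; split=> // i.
  rewrite size_cat nth_cat => lti; case: ltnP => [|le_i]; first exact: simp1.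
  by apply: simp2; rewrite ltn_subLR.
exists [:: C]; rewrite !big_seq1; split=> // -[|//] _; split=> // E sE EC.
have [-> | nzE] := eqVneq E 0%VS; first by left.
right; apply/eqP; apply/negP => /negP neqE; apply: simpC.
by exists E.
Qed.

End Coseparability.

(** * The normalized integral of a cosemisimple Hopf algebra *)

Section Haar.
Variables (k : fieldType) (H : hopfAlgebra k).
Local Notation "'Δ'" := (@comul k H).
Local Notation ε := (@counit k H).

Record haar_integral (λ : {scalar H}) : Prop := HaarIntegral {
  haar1 : λ 1 = 1;
  haar_left : forall h : H, tlift (fun a b => λ b *: a) (Δ h) = λ h *: (1 : H);
  haar_right : forall h : H, tlift (fun a b => λ a *: b) (Δ h) = λ h *: (1 : H)
}.

(** The coordinate functional [ε π_i] of a summand acts on [H] as the projection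
    [π_i], on either side, since [Δ] maps each summand into its own tensor
    square. Applied to [1] this shows that [π_i 1] is a multiple of [1], so that
    a summand with [π_i 1 != 0] contains [1], and by simplicity it is the line
    of [1]; then [λ = ε π_i]. *)
Lemma cosemisimple_haar : cosemisimple H -> exists λ, haar_integral λ.
Proof.
case=> n [D [simD dirD sumD]].
pose defV := esym sumD; pose π i : 'End(H) := sumv_pi_for defV i.
have sum_pi h : \sum_i π i h = h by apply: sumv_pi_sum; apply: memvf.
have piD i h : π i h \in D i by apply: memv_sum_pi.
have pi_delta i j d : d \in D j -> π i d = (i == j)%:R *: d.
  move=> Dd; apply/eqP; rewrite -subr_eq0; apply/eqP.
  apply: (directv_sum_independent dirD (fun i => π i d - (i == j)%:R *: d)) => //.
    move=> l _; rewrite memvB ?piD //.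
    by case: eqP => [->|_]; rewrite ?scale0r ?mem0v // scale1r.
  rewrite sumrB sum_pi (bigD1 j) //= eqxx scale1r big1 ?addr0 ?subrr //.
  by move=> l /negPf->; rewrite scale0r.
have lin_sum (g1 g2 : H -> H) h : linear g1 -> linear g2 ->
    (forall j d, d \in D j -> g1 d = g2 d) -> g1 h = g2 h.
  move=> l1 l2 g12; rewrite -[h]sum_pi.
  pose M1 := GRing.isLinear.Build _ _ _ _ g1 l1.
  pose M2 := GRing.isLinear.Build _ _ _ _ g2 l2.
  pose G1 : {linear H -> H} := HB.pack g1 M1.
  pose G2 : {linear H -> H} := HB.pack g2 M2.
  transitivity (\sum_i G1 (π i h)); first by rewrite -linear_sum.
  transitivity (\sum_i G2 (π i h)); last by rewrite -linear_sum.
  by apply: eq_bigr => i _; apply: (g12 i).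
have pil i h : tlift (fun a b => ε (π i a) *: b) (Δ h) = π i h.
  apply: (lin_sum (fun h => tlift (fun a b => ε (π i a) *: b) (Δ h))); try by repeat lin1.
  move=> j d Dd; rewrite (pi_delta i j) // -[in RHS](counitl d).
  have [sDj _ _] := simD j.
  rewrite (tlift_post _ _ (g := fun z => _ *: z)); last exact: lin_scaler (@lin_id _ _).
  apply: (eq_tlift_tensv (sDj _ Dd)); try by split; repeat lin1.
  by move=> a b Da _; rewrite (pi_delta i j) // linearZ /= scalerA.
have pir i h : tlift (fun a b => ε (π i b) *: a) (Δ h) = π i h.
  apply: (lin_sum (fun h => tlift (fun a b => ε (π i b) *: a) (Δ h))); try by repeat lin1.
  move=> j d Dd; rewrite (pi_delta i j) // -[in RHS](counitr d).
  have [sDj _ _] := simD j.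
  rewrite (tlift_post _ _ (g := fun z => _ *: z)); last exact: lin_scaler (@lin_id _ _).
  apply: (eq_tlift_tensv (sDj _ Dd)); try by split; repeat lin1.
  by move=> a b _ Db; rewrite (pi_delta i j) // linearZ /= scalerA.
have [i pi1] : exists i, π i 1 != 0.
  apply/existsP; rewrite -negb_forall; apply/negP => /forallP pi0.
  have /negP[] := oner_neq0 H; rewrite -[X in X == _](sum_pi 1) big1 //.
  by move=> i _; apply/eqP; have := pi0 i; case: eqP.
have pi1E : π i 1 = ε (π i 1) *: (1 : H).
  rewrite -[LHS]pil rmorph1 tlift1 //.
  by split; repeat lin1.
have D1 : 1 \in D i.
  have c0 : ε (π i 1) != 0 by apply: contraNneq pi1 => c0; rewrite pi1E c0 scale0r.
  by rewrite -(scalerK c0 1) -pi1E memvZ.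
have DE : (<[1]>)%VS = D i.
  have [_ _ minD] := simD i.
  have [||/eqP|//] := minD <[1]>%VS.
  - move=> _ /vlineP[c ->]; rewrite linearZ rmorph1 memvZ //=.
    by apply: mem_tensv; apply: memv_line.
  - by rewrite -memvE.
  - by rewrite -dimv_eq0 dim_vline oner_eq0.
have piE h : π i h = ε (π i h) *: (1 : H).
  have := piD i h; rewrite -DE => /vlineP[c ->].
  by rewrite linearZ /= rmorph1 mulr1.
pose λ : {scalar H} := ε \o π i.
exists λ; split.
- by rewrite /λ /= (pi_delta i i) // eqxx scale1r rmorph1.
- by move=> h; rewrite [LHS]pir piE.
- by move=> h; rewrite [LHS]pil piE.
Qed.

End Haar.

(** * Antipode identities and nondegenerate forms *)

Section AntipodeContractions.
Variables (k : fieldType) (H : hopfAlgebra k).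
Local Notation "'Δ'" := (@comul k H).
Local Notation ε := (@counit k H).
Local Notation S := (@antipode k H).

Section Contractions.
Variables (V : lmodType k) (G : H -> H -> V) (bG : bilin G).

Let lG1 b : linear (fun a => G a b). Proof. exact: bG.1. Qed.
Let lG2 a : linear (fun b => G a b). Proof. exact: bG.2. Qed.

Lemma antipodel_fst y :
  tlift (fun a b => tlift (fun c d => G (S c * d) b) (Δ a)) (Δ y) = G 1 y.
Proof.
rewrite -(counitl_lin (g := G 1)) //; apply: eq_tlift => a b.
by rewrite -(tlift_post _ _ (g := G^~ b)) // antipodel (linZ _ _ (lG1 b)).
Qed.

Lemma antipoder_fst y :
  tlift (fun a b => tlift (fun c d => G (c * S d) b) (Δ a)) (Δ y) = G 1 y.
Proof.
rewrite -(counitl_lin (g := G 1)) //; apply: eq_tlift => a b.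
by rewrite -(tlift_post _ _ (g := G^~ b)) // antipoder (linZ _ _ (lG1 b)).
Qed.

Lemma antipodel_snd y :
  tlift (fun a b => tlift (fun c d => G a (S c * d)) (Δ b)) (Δ y) = G y 1.
Proof.
rewrite -(counitr_lin (g := G^~ 1)) //; apply: eq_tlift => a b.
by rewrite -(tlift_post _ _ (g := G a)) // antipodel (linZ _ _ (lG2 a)).
Qed.

Lemma antipoder_snd y :
  tlift (fun a b => tlift (fun c d => G a (c * S d)) (Δ b)) (Δ y) = G y 1.
Proof.
rewrite -(counitr_lin (g := G^~ 1)) //; apply: eq_tlift => a b.
by rewrite -(tlift_post _ _ (g := G a)) // antipoder (linZ _ _ (lG2 a)).
Qed.

End Contractions.

(** [Δ S] and [h => S(h_2) ⊗ S(h_1)] are a left and a right convolution inverse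
    of [Δ], hence equal. *)
Lemma comul_antipode h : Δ (S h) = tlift (fun a b => S b ⊗ S a) (Δ h).
Proof.
pose R h := tlift (fun a b => S b ⊗ S a) (Δ h).
have lRf (X : lmodType k) (f : X -> H) : linear f -> linear (fun x => R (f x)).
  by move=> lf; rewrite /R; repeat lin1.
have DR x : tlift (fun a b => Δ a * R b) (Δ x) = ε x *: (1 : H ⊗ H).
  pose F a1 a2 b : H ⊗ H := tlift (fun c d => (a1 * S d) ⊗ (a2 * S c)) (Δ b).
  transitivity (tlift (fun a b => tlift (fun a1 a2 => F a1 a2 b) (Δ a)) (Δ x)).
    apply: eq_tlift => a b; rewrite -[in LHS](tens_decomp (Δ a)).
    rewrite (tlift_post _ _ (g := fun z => z * R b)); last by repeat lin1.
    apply: eq_tlift => a1 a2.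
    rewrite /R (tlift_post _ _ (g := fun z => (a1 ⊗ a2) * z)); last by repeat lin1.
    by apply: eq_tlift => c d; rewrite ptensM.
  rewrite coassoc /F; try by repeat lin1.
  transitivity (tlift (fun a b => (a * S b) ⊗ (1 : H)) (Δ x)).
    apply: eq_tlift => a b; rewrite -coassoc; try by repeat lin1.
    by rewrite (antipoder_fst (G := fun z w => (a * S w) ⊗ z)) //; split; repeat lin1.
  rewrite -(tlift_post _ _ (g := fun z => z ⊗ (1 : H))); last by repeat lin1.
  by rewrite antipoder (linZ (g := fun z => z ⊗ (1 : H))) //; repeat lin1.
have SD x : tlift (fun a b => Δ (S a) * Δ b) (Δ x) = ε x *: (1 : H ⊗ H).
  under eq_tlift do rewrite -rmorphM.
  by rewrite -(tlift_post _ _ (g := Δ)) ?antipodel ?linearZ /= ?rmorph1 //; repeat lin1.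
transitivity (tlift (fun a b => tlift (fun c d => Δ (S a) * (Δ c * R d)) (Δ b)) (Δ h)).
  rewrite -[in LHS](counitr_lin (g := fun z => Δ (S z))); last by repeat lin1.
  apply: eq_tlift => a b.
  rewrite -(tlift_post _ _ (g := fun z => Δ (S a) * z)); last by repeat lin1.
  by rewrite DR -scalerAr mulr1.
rewrite -coassoc; try by do ?[lin1 | apply: lRf].
rewrite -[RHS](counitl_lin (g := R)); last by apply: lRf; exact: lin_id.
apply: eq_tlift => a b; under eq_tlift => c d do rewrite mulrA.
rewrite -(tlift_post _ _ (g := fun z => z * R b)); last by repeat lin1.
by rewrite SD -scalerAl mul1r.
Qed.

End AntipodeContractions.

Section Forms.
Variables (k : fieldType) (H : falgType k) (λ : {scalar H}) (m : H -> H -> H).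
Hypothesis bm : bilin m.

(** In finite dimension a form [λ (m x y)] nondegenerate on one side represents
    every functional; the form is given through a bilinear map [m] so that the
    flipped product is covered too. *)
Lemma form_repr :
    (forall x, (forall y, λ (m x y) = 0) -> x = 0) ->
  forall f : {scalar H}, exists x, forall y, λ (m x y) = f y.
Proof.
move=> nd f; pose n := \dim {:H}; pose e (i : 'I_n) : H := (vbasis {:H})`_i.
pose ml y := HB.pack_for {linear H -> H} (m^~ y) (GRing.isLinear.Build _ _ _ _ _ (bm.1 y)).
pose mr x := HB.pack_for {linear H -> H} (m x) (GRing.isLinear.Build _ _ _ _ _ (bm.2 x)).
have mlE (v : 'rV[k]_n) y :
    λ (m (\sum_i v 0 i *: e i) y) = \sum_i v 0 i * λ (m (e i) y).
  rewrite -[m _ y]/(ml y _) !linear_sum; apply: eq_bigr => i _.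
  by rewrite !linearZ.
pose G := \matrix_(i, j) λ (m (e i) (e j)).
have mG (v : 'rV[k]_n) j : λ (m (\sum_i v 0 i *: e i) (e j)) = (v *m G) 0 j.
  by rewrite mlE mxE; apply: eq_bigr => i _; rewrite mxE.
have ext x (g : {scalar H}) :
    (forall j, λ (m x (e j)) = g (e j)) -> forall y, λ (m x y) = g y.
  move=> xg y; rewrite (coord_vbasis (memvf y)) -[m x _]/(mr x _) !linear_sum.
  by apply: eq_bigr => j _; rewrite !linearZ /=; congr (_ * _); apply: xg.
have uG : G \in unitmx.
  rewrite -row_free_unit; apply: inj_row_free => v vG.
  have /freeP/(_ (v 0)) vfree : free (vbasis {:H}) by apply: basis_free (vbasisP _).
  apply/rowP => i; rewrite [RHS]mxE; apply: vfree; apply: nd.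
  by apply: (ext _ (\0 : {scalar H})) => j; rewrite mG vG mxE.
exists (\sum_i (\row_j f (e j) *m invmx G) 0 i *: e i).
by apply: ext => j; rewrite mG mulmxKV // mxE.
Qed.

End Forms.

(** * The Frobenius form of the integral and its Nakayama automorphism *)

Lemma tlift_sum (k : fieldType) (A B : falgType k) (V : lmodType k) (I : finType)
    (f : I -> A -> B -> V) (t : A ⊗ B) :
  tlift (fun a b => \sum_i f i a b) t = \sum_i tlift (f i) t.
Proof.
rewrite /tlift [RHS]exchange_big; apply: eq_bigr => p _.
rewrite [RHS]exchange_big; apply: eq_bigr => q _.
by rewrite scaler_sumr.
Qed.

Section HaarForm.
Variables (k : fieldType) (H : hopfAlgebra k).
Variables (λ : {scalar H}) (hλ : haar_integral λ).
Local Notation "'Δ'" := (@comul k H).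
Local Notation ε := (@counit k H).
Local Notation S := (@antipode k H).
Implicit Types x y z : H.

(** Scalar identities are proved after multiplication by [1], because [tlift]
    takes its values in modules. *)
Lemma scale1_inj (c d : k) : c *: (1 : H) = d *: 1 -> c = d.
Proof. by move=> /(congr1 λ); rewrite !linearZ /= (haar1 hλ) !mulr1. Qed.

(** The three identities below come from inserting the invariance of [λ] at a
    product and cancelling an antipode. In Sweedler's notation this one reads
    [λ (x_1 y) x_2 = λ (x y_1) S(y_2)]. *)
Lemma haar_mulr x y :
  tlift (fun a b => λ (a * y) *: b) (Δ x) =
  tlift (fun a b => λ (x * a) *: S b) (Δ y).
Proof.
transitivity (tlift (fun c d => tlift (fun a b =>
    tlift (fun c1 c2 => λ (a * c1) *: (b * (c2 * S d))) (Δ c)) (Δ x)) (Δ y)); last first.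
  apply: eq_tlift => c d; rewrite -[S d in RHS]mul1r scalerAl -(haar_right hλ).
  rewrite (tlift_post _ _ (g := fun z => z * S d)); last by repeat lin1.
  rewrite rmorphM tlift_mul; last by split; repeat lin1.
  by apply: eq_tlift => a b; apply: eq_tlift => c1 c2; rewrite -!scalerAl !mulrA.
rewrite exchange_tlift; apply: eq_tlift => a b.
rewrite coassoc; try by repeat lin1.
by rewrite (antipoder_snd (G := fun c z => λ (a * c) *: (b * z))) ?mulr1 //;
  split; repeat lin1.
Qed.

(** [S(x_1) λ (x_2 y) = y_1 λ (x y_2)]. *)
Lemma haar_mull x y :
  tlift (fun a b => λ (b * y) *: S a) (Δ x) =
  tlift (fun a b => λ (x * b) *: a) (Δ y).
Proof.
transitivity (tlift (fun a b => tlift (fun b1 b2 =>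
    tlift (fun c d => λ (b2 * d) *: (S a * b1 * c)) (Δ y)) (Δ b)) (Δ x)).
  apply: eq_tlift => a b; rewrite -[S a in LHS]mulr1 scalerAr -(haar_left hλ).
  rewrite (tlift_post _ _ (g := fun z => S a * z)); last by repeat lin1.
  rewrite rmorphM tlift_mul; last by split; repeat lin1.
  by apply: eq_tlift => b1 b2; apply: eq_tlift => c d; rewrite -!scalerAr !mulrA.
rewrite -coassoc; try by repeat lin1.
rewrite (antipodel_fst (G := fun z b => tlift (fun c d => λ (b * d) *: (z * c)) (Δ y)));
  last by split; repeat lin1.
by apply: eq_tlift => c d; rewrite mul1r.
Qed.

(** [x_1 λ (x_2 S(y)) = λ (x S(y_1)) y_2]: the shift property of the pairing
    [λ (x S(y))]. *)
Lemma haar_antipode x y :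
  tlift (fun a b => λ (b * S y) *: a) (Δ x) =
  tlift (fun a b => λ (x * S a) *: b) (Δ y).
Proof.
transitivity (tlift (fun c d => tlift (fun a b =>
    tlift (fun c1 c2 => λ (b * S c1) *: (a * (S c2 * d))) (Δ c)) (Δ x)) (Δ y)); last first.
  apply: eq_tlift => c d; rewrite -[d in RHS]mul1r scalerAl -(haar_left hλ).
  rewrite (tlift_post _ _ (g := fun z => z * d)); last by repeat lin1.
  rewrite rmorphM /= comul_antipode tlift_mul; last by split; repeat lin1.
  apply: eq_tlift => a b; symmetry; rewrite (tlift_post _ _ (g :=
    tlift (fun a' b' => λ (b * b') *: (a * a') * d))); last by repeat lin1.
  apply: eq_tlift => c1 c2; rewrite tliftE; last by split; repeat lin1.
  by rewrite -!scalerAl !mulrA.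
rewrite exchange_tlift; apply: eq_tlift => a b.
rewrite coassoc; try by repeat lin1.
by rewrite (antipodel_snd (G := fun c z => λ (b * S c) *: (a * z))) ?mulr1 //;
  split; repeat lin1.
Qed.

(** If [λ (x y) = 0] for all [y], then [λ (x_1 y) x_2 = λ (x y_1) S(y_2) = 0] for
    all [y], whence [x = λ (x_1 S(x_2)) x_3 = 0]. *)
Lemma haar_nondeg x : (forall y, λ (x * y) = 0) -> x = 0.
Proof.
move=> x0.
have F0 y : tlift (fun a b => λ (a * y) *: b) (Δ x) = 0.
  by rewrite haar_mulr /tlift big1 // => i _; rewrite big1 // => j _; rewrite x0 scale0r scaler0.
pose e i : H := (vbasis {:H})`_i; pose c i : {scalar H} := coord (vbasis {:H}) i.
have xE : x = tlift (fun p b => tlift (fun a d => λ (a * S d) *: b) (Δ p)) (Δ x).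
  rewrite -[LHS]counitl; apply: eq_tlift => p b.
  transitivity (λ (ε p *: 1) *: b); first by rewrite linearZ /= (haar1 hλ) mulr1.
  by rewrite -antipoder (tlift_post _ _ (g := fun z => λ z *: b)) //; repeat lin1.
rewrite xE coassoc; try by repeat lin1.
(* Expanding [x_2] in a basis [e_i] separates it from [x_1]. *)
transitivity (\sum_(i < \dim {:H}) tlift (fun p q => c i p *: q)
    (Δ (tlift (fun a b => λ (a * S (e i)) *: b) (Δ x)))); last first.
  by rewrite big1 // => i _; rewrite F0 linear0 /tlift big1 // => p _;
     rewrite big1 // => q _; rewrite mxE scale0r.
transitivity (tlift (fun a b => \sum_(i < \dim {:H})
    λ (a * S (e i)) *: tlift (fun p q => c i p *: q) (Δ b)) (Δ x)).
  apply: eq_tlift => a b; under [RHS]eq_bigr => i _.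
    rewrite (tlift_post _ _ (g := fun z => _ *: z)); last exact: lin_scaler (@lin_id _ _).
    over.
  rewrite -tlift_sum; apply: eq_tlift => p q; rewrite [in LHS](coord_vbasis (memvf p)).
  rewrite linear_sum mulr_sumr linear_sum scaler_suml; apply: eq_bigr => i _.
  by rewrite linearZ -scalerAr linearZ /= scalerA mulrC.
rewrite tlift_sum; apply: eq_bigr => i _.
rewrite [in RHS](tlift_post _ _ (g := fun z => tlift (fun p q => c i p *: q) (Δ z)));
  last by repeat lin1.
apply: eq_tlift => a b.
by rewrite (linZ (g := fun z => tlift (fun p q => c i p *: q) (Δ z))) //; repeat lin1.
Qed.

Lemma haar_represents_l (f : {scalar H}) : exists x, forall y, λ (x * y) = f y.
Proof. by apply: form_repr haar_nondeg f; split; repeat lin1. Qed.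

(** If [N] represents the counit, then [z = S(N_1) λ (N_2 z)] by [haar_mull]. *)
Lemma haar_nondegl z : (forall y, λ (y * z) = 0) -> z = 0.
Proof.
move=> z0; have [N NE] := haar_represents_l ε.
rewrite -[z]counitr; under eq_tlift => a b do rewrite -NE.
by rewrite -haar_mull /tlift big1 // => i _; rewrite big1 // => j _; rewrite z0 scale0r scaler0.
Qed.

Lemma haar_represents_r (f : {scalar H}) : exists x, forall y, λ (y * x) = f y.
Proof.
apply: (form_repr (m := fun x y => y * x)) haar_nondegl f.
by split; repeat lin1.
Qed.

Section Nakayama.
Variables (M : H) (hM : forall y, λ (y * M) = ε y).

(** When [M] represents the counit, [M_1] and [S(M_2)] run through dual bases
    for the form [λ (x y)], since [y = λ (y M_1) S(M_2)] by [haar_mulr]. Hence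
    the formula for the element representing [y => λ (x y)]. *)
Definition nakayama (x : H) : H := tlift (fun a b => λ (x * S b) *: a) (Δ M).

Lemma lin_nakayama : linear nakayama.
Proof. by rewrite /nakayama; repeat lin1. Qed.

HB.instance Definition _ := GRing.isLinear.Build k H H _ nakayama lin_nakayama.

Local Notation σ := nakayama.

Lemma nakayamaE x y : λ (x * y) = λ (y * σ x).
Proof.
apply: scale1_inj.
have -> : y = tlift (fun a b => λ (y * a) *: S b) (Δ M).
  rewrite -haar_mulr -[LHS]counitl; apply: eq_tlift => a b; by rewrite hM.
set y' := tlift _ _; rewrite [LHS](tlift_post _ _ (g := fun z => λ (x * z) *: (1 : H)));
  last by repeat lin1.
have y'E : y' = y.
  rewrite /y' -haar_mulr -[RHS]counitl; apply: eq_tlift => a b; by rewrite hM.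
rewrite y'E /nakayama.
rewrite [RHS](tlift_post _ _ (g := fun z => λ (y * z) *: (1 : H))); last by repeat lin1.
apply: eq_tlift => a b.
by rewrite -!scalerAr !linearZ /= mulrC.
Qed.

Lemma nakayamaM x y : σ (x * y) = σ x * σ y.
Proof.
apply/eqP; rewrite -subr_eq0; apply/eqP; apply: haar_nondegl => z.
rewrite mulrBr linearB /= -nakayamaE -mulrA nakayamaE -mulrA.
by rewrite nakayamaE -[X in _ - X]/(λ _) !mulrA subrr.
Qed.

(** Evaluate [haar_mull] at an element [N] representing the counit on the left,
    once at [(N, σ x)] and once at [(x, N)]. *)
Lemma nakayama_antipode x :
  σ x = tlift (fun a b => ε (σ b) *: S (S a)) (Δ x).
Proof.
have [N NE] := haar_represents_l ε.
rewrite -[LHS]counitr; under eq_tlift => a b do rewrite -NE.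
rewrite -haar_mull; under eq_tlift => a b do rewrite -nakayamaE.
have := haar_mull x N.
move=> /(congr1 S).
rewrite (tlift_post _ _ (g := S)); last by repeat lin1.
rewrite (tlift_post _ _ (g := S)); last by repeat lin1.
under eq_tlift => a b do rewrite linearZ /= nakayamaE NE.
under [RHS]eq_tlift => a b do rewrite linearZ /=.
by move->.
Qed.
End Nakayama.
End HaarForm.

(** * Unimodularity from the R-matrix *)

Section MatrixLemma.
Variables (k : fieldType) (m n : nat).

(** With [A = C R] a full rank factorization, [A B A = 0] forces [R B C = 0],
    and the trace is cyclic. *)
Lemma mxtrace_sandwich0 (A : 'M[k]_(m, n)) (B : 'M[k]_(n, m)) :
  A *m B *m A = 0 -> \tr (A *m B) = 0.
Proof.
rewrite -{1 2}(mulmx_base A) !mulmxA => E.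
have : row_base A *m B *m col_base A = 0.
  apply: (row_full_inj (col_base_full A)); apply: (row_free_inj (row_base_free A)).
  by rewrite mulmx0 mul0mx !mulmxA.
by move=> E0; rewrite -{1}(mulmx_base A) -mulmxA mxtrace_mulC E0 mxtrace0.
Qed.

End MatrixLemma.

Lemma tlift_coef (k : fieldType) (A B C D : falgType k) (f : A -> B -> C ⊗ D)
    (t : A ⊗ B) i j :
  tlift f t i j = \sum_p \sum_q t p q * f (vbasis {:A})`_p (vbasis {:B})`_q i j.
Proof.
rewrite /tlift summxE; apply: eq_bigr => p _; rewrite summxE.
by apply: eq_bigr => q _; rewrite mxE.
Qed.

Section RMatrix.
Variables (k : fieldType) (H : hopfAlgebra k) (r : (H ⊗ H)%type).
Hypothesis Rr : universal_R r.
Local Notation "'Δ'" := (@comul k H).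
Local Notation ε := (@counit k H).
Local Notation S := (@antipode k H).

Section Hexagons.
Variables (V : lmodType k) (F : H -> H -> H -> V).
Hypothesis l1 : forall b c, linear (fun a => F a b c).
Hypothesis l2 : forall a c, linear (fun b => F a b c).
Hypothesis l3 : forall a b, linear (fun c => F a b c).

Let L := tlift (fun a => @tlift k H H V (F a)).
Let lL : linear L. Proof. by rewrite /L; repeat lin1. Qed.
Let LE a b c : L (a ⊗ (b ⊗ c)) = F a b c.
Proof. by rewrite /L !tliftE //; split; repeat lin1. Qed.

Let lLf (X : lmodType k) (f : X -> (H ⊗ (H ⊗ H))%type) :
  linear f -> linear (fun x => L (f x)).
Proof. by move=> lf c u v; rewrite lf lL. Qed.

Lemma hexagonl_tlift :
  tlift (fun a b => tlift (fun a1 a2 => F a1 a2 b) (Δ a)) r =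
  tlift (fun a b => tlift (fun c d => F a c (b * d)) r) r.
Proof.
have := congr1 L (R_hexagonl Rr); rewrite /tmap => E.
transitivity (L (tassoc (tlift (fun a b => Δ a ⊗ b) r))).
  rewrite (tlift_post _ _ (@tassoc_lin k H H H)) (tlift_post _ _ lL).
  apply: eq_tlift => a b; rewrite /tassoc tliftE; last exact: tassoc_bilin.
  by rewrite (tlift_post _ _ lL); apply: eq_tlift => a1 a2; rewrite LE.
rewrite E /R13 /R23 /tmap -[X in _ * (1 ⊗ X)](tens_decomp r).
rewrite [LHS](tlift_post _ _ (g := fun z => L (z * _))); last by apply: lLf; repeat lin1.
apply: eq_tlift => a b.
rewrite (tlift_post _ _ (g := fun z => L (_ * (1 ⊗ z)))); last by apply: lLf; repeat lin1.
by apply: eq_tlift => c d; rewrite !ptensM LE mulr1 mul1r.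
Qed.

Lemma hexagonr_tlift :
  tlift (fun a b => tlift (fun b1 b2 => F a b1 b2) (Δ b)) r =
  tlift (fun a b => tlift (fun c d => F (a * c) d b) r) r.
Proof.
have := congr1 L (R_hexagonr Rr); rewrite /tmap => E.
transitivity (L (tlift (fun a b => a ⊗ Δ b) r)).
  rewrite (tlift_post _ _ lL).
  by apply: eq_tlift => a b; rewrite /L tliftE //; split; repeat lin1.
rewrite E /R13 /R12 /tmap.
rewrite [LHS](tlift_post _ _ (g := fun z => L (z * _))); last by apply: lLf; repeat lin1.
apply: eq_tlift => a b.
rewrite (tlift_post _ _ (g := fun z => L (_ * z))); last by apply: lLf; repeat lin1.
by apply: eq_tlift => c d; rewrite !ptensM LE mulr1 mul1r.
Qed.

End Hexagons.

(** The second hexagon gives [r = (e ⊗ 1) r] for this contraction [e]. *)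
Lemma R_counitr : tlift (fun a b => ε b *: a) r = 1.
Proof.
have E : tlift (fun a b => tlift (fun b1 b2 => ε b2 *: (a ⊗ b1)) (Δ b)) r = r.
  rewrite -[RHS]tens_decomp; apply: eq_tlift => a b.
  by rewrite (counitr_lin (g := fun z => a ⊗ z)) //; repeat lin1.
rewrite (hexagonr_tlift (F := fun a b c => ε c *: (a ⊗ b))) in E; try by repeat lin1.
set e := tlift _ _; have E1 : (e ⊗ 1) * r = r.
  rewrite -[RHS]E /e (tlift_post _ _ (g := fun z => (z ⊗ 1) * r)); last by repeat lin1.
  apply: eq_tlift => a b; rewrite -[X in _ * X](tens_decomp r).
  rewrite (tlift_post _ _ (g := fun z => ((ε b *: a) ⊗ 1) * z)); last by repeat lin1.
  apply: eq_tlift => c d; rewrite ptensM mul1r -scalerAl (linZ (g := fun z => z ⊗ d)) //.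
  by repeat lin1.
have {}E1 : e ⊗ 1 = 1 :> H ⊗ H.
  by rewrite -[LHS](mulrK (R_unit Rr)) E1 mulrV // (R_unit Rr).
have := congr1 (tlift (fun a b : H => ε b *: a)) E1.
rewrite -ptens1 !tliftE; try by split; repeat lin1.
by rewrite rmorph1 !scale1r.
Qed.

Section Haar.
Variables (λ : {scalar H}) (hλ : haar_integral λ).

(** An integral of the Hopf subalgebra spanned by the second legs of [r]; the
    lemmas below express this as [r_1 ⊗ r_2 ℓ = r_1 ⊗ ℓ r_2 = 1 ⊗ ℓ], and the
    same with [S(r_2)] and [S^2(r_2)] on the right of [ℓ]. *)
Definition R_haar : H := tlift (fun a b => λ a *: b) r.
Local Notation ℓ := R_haar.

Lemma counit_R_haar : ε ℓ = 1.
Proof.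
apply: (scale1_inj hλ); rewrite scale1r.
rewrite /ℓ (tlift_post _ _ (g := fun z => ε z *: (1 : H))); last by repeat lin1.
transitivity (λ (tlift (fun a b => ε b *: a) r) *: (1 : H)).
  rewrite [RHS](tlift_post _ _ (g := fun z => λ z *: (1 : H))); last by repeat lin1.
  by apply: eq_tlift => a b; rewrite !linearZ /= mulrC.
by rewrite R_counitr (haar1 hλ) scale1r.
Qed.

Lemma R_haar_mull : tlift (fun a b => a ⊗ (b * ℓ)) r = 1 ⊗ ℓ.
Proof.
transitivity (tlift (fun a b => tlift (fun c d => λ c *: (a ⊗ (b * d))) r) r).
  apply: eq_tlift => a b; rewrite /ℓ (tlift_post _ _ (g := fun z => a ⊗ (b * z))); last by repeat lin1.
  by apply: eq_tlift => c d; rewrite (linZ (g := fun z => a ⊗ (b * z))) //; repeat lin1.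
rewrite -(hexagonl_tlift (F := fun a b c => λ b *: (a ⊗ c))); try by repeat lin1.
rewrite /ℓ [RHS](tlift_post _ _ (g := fun z => 1 ⊗ z)); last by repeat lin1.
apply: eq_tlift => a b.
transitivity ((tlift (fun c d => λ d *: c) (Δ a)) ⊗ b : H ⊗ H).
  rewrite [RHS](tlift_post _ _ (g := fun z => z ⊗ b)); last by repeat lin1.
  by apply: eq_tlift => c d; rewrite (linZ (g := fun z => z ⊗ b)) //; repeat lin1.
rewrite (haar_left hλ) (linZ (g := fun z => z ⊗ b)); last by repeat lin1.
by rewrite (linZ (g := fun z => (1 : H) ⊗ z)) //; repeat lin1.
Qed.

Lemma R_haar_mulr : tlift (fun a b => a ⊗ (ℓ * b)) r = 1 ⊗ ℓ.
Proof.
transitivity (tlift (fun a b => tlift (fun c d => λ a *: (c ⊗ (b * d))) r) r).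
  rewrite exchange_tlift; apply: eq_tlift => a b.
  rewrite /ℓ (tlift_post _ _ (g := fun z => a ⊗ (z * b))); last by repeat lin1.
  by apply: eq_tlift => c d; rewrite (linZ (g := fun z => a ⊗ (z * b))) //; repeat lin1.
rewrite -(hexagonl_tlift (F := fun a b c => λ a *: (b ⊗ c))); try by repeat lin1.
rewrite /ℓ [RHS](tlift_post _ _ (g := fun z => 1 ⊗ z)); last by repeat lin1.
apply: eq_tlift => a b.
transitivity ((tlift (fun c d => λ c *: d) (Δ a)) ⊗ b : H ⊗ H).
  rewrite [RHS](tlift_post _ _ (g := fun z => z ⊗ b)); last by repeat lin1.
  by apply: eq_tlift => c d; rewrite (linZ (g := fun z => z ⊗ b)) //; repeat lin1.
rewrite (haar_right hλ) (linZ (g := fun z => z ⊗ b)); last by repeat lin1.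
by rewrite (linZ (g := fun z => (1 : H) ⊗ z)) //; repeat lin1.
Qed.

(** Expand [1 ⊗ ℓ = r_1 ⊗ ℓ (r_2)_1 S((r_2)_2)] by the second hexagon and absorb
    [(r_2)_1] into [ℓ]. *)
Lemma R_haar_antipode : tlift (fun a b => a ⊗ (ℓ * S b)) r = 1 ⊗ ℓ.
Proof.
transitivity (tlift (fun a b => tlift (fun c d => (a * c) ⊗ (ℓ * (d * S b))) r) r).
  apply: eq_tlift => a b; transitivity ((a ⊗ 1) * (1 ⊗ ℓ) * (1 ⊗ S b) : H ⊗ H).
    by rewrite !ptensM !mulr1 mul1r.
  rewrite -R_haar_mulr (tlift_post _ _ (g := fun z => (a ⊗ 1) * z * (1 ⊗ S b))); last by repeat lin1.
  by apply: eq_tlift => c d; rewrite !ptensM !mulr1 mul1r mulrA.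
rewrite -(hexagonr_tlift (F := fun a b c => a ⊗ (ℓ * (b * S c)))); try by repeat lin1.
transitivity ((tlift (fun a b => ε b *: a) r) ⊗ ℓ : H ⊗ H); last by rewrite R_counitr.
rewrite [RHS](tlift_post _ _ (g := fun z => z ⊗ ℓ)); last by repeat lin1.
apply: eq_tlift => a b.
rewrite -(tlift_post _ _ (g := fun z => a ⊗ (ℓ * z))); last by repeat lin1.
rewrite antipoder -scalerAr mulr1 (linZ (g := fun z => a ⊗ z)); last by repeat lin1.
by rewrite (linZ (g := fun z => z ⊗ ℓ)) //; repeat lin1.
Qed.

(** The same argument applied to [1 ⊗ ℓ = r_1 ⊗ ℓ S(S((r_2)_1) (r_2)_2)]. *)
Lemma R_haar_antipode2 : tlift (fun a b => a ⊗ (ℓ * S (S b))) r = 1 ⊗ ℓ.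
Proof.
transitivity (tlift (fun a b => tlift (fun c d => (a * c) ⊗ (ℓ * S (S d * b))) r) r).
  rewrite exchange_tlift.
  apply: eq_tlift => a b; transitivity ((1 ⊗ ℓ) * (a ⊗ S (S b)) : H ⊗ H).
    by rewrite !ptensM mul1r.
  rewrite -R_haar_antipode (tlift_post _ _ (g := fun z => z * (a ⊗ S (S b)))); last by repeat lin1.
  by apply: eq_tlift => c d; rewrite !ptensM antipodeM mulrA.
rewrite -(hexagonr_tlift (F := fun a b c => a ⊗ (ℓ * S (S b * c)))); try by repeat lin1.
transitivity ((tlift (fun a b => ε b *: a) r) ⊗ ℓ : H ⊗ H); last by rewrite R_counitr.
rewrite [RHS](tlift_post _ _ (g := fun z => z ⊗ ℓ)); last by repeat lin1.
apply: eq_tlift => a b.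
rewrite -(tlift_post _ _ (g := fun z => a ⊗ (ℓ * S z))); last by repeat lin1.
rewrite antipodel linearZ /= antipode1 -scalerAr mulr1 (linZ (g := fun z => a ⊗ z)); last by repeat lin1.
by rewrite (linZ (g := fun z => z ⊗ ℓ)) //; repeat lin1.
Qed.

Lemma tlift_comul_R_haar (V : lmodType k) (f : H -> H -> V) : bilin f ->
  tlift f (Δ ℓ) = tlift (fun a b => tlift (fun c d => λ (a * c) *: f d b) r) r.
Proof.
move=> [lf1 lf2].
have lf2' a : linear (fun b => f a b) by exact: lf2.
rewrite -(hexagonr_tlift (F := fun a b c => λ a *: f b c)); try by repeat lin1.
rewrite /ℓ (tlift_post _ _ (g := fun z => tlift f (Δ z))); last by repeat lin1.
apply: eq_tlift => a b; rewrite (linZ (g := fun z => tlift f (Δ z))); last by repeat lin1.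
by rewrite (tlift_post _ _ (g := fun z => λ a *: z)) //; apply: lin_scaler (@lin_id _ _).
Qed.

(** By [haar_mulr], [r_1 ⊗ λ (ℓ_1 S(r_2)) ℓ_2 = λ ℓ r_1 ⊗ S^2(r_2)]. If [λ ℓ]
    vanished, the left side would be zero; with the coordinates of [r] as a
    matrix [A] and [B_ij = λ (e_j R_1) λ (R_2 S(e_i))], this reads
    [A B A = 0], while [tr (A B) = λ (ℓ_1 S(ℓ_2)) = ε ℓ = 1]. *)
Lemma haar_R_haar_neq0 : λ ℓ != 0.
Proof.
apply/eqP => λℓ0.
pose n := \dim {:H}; pose e (i : 'I_n) : H := (vbasis {:H})`_i.
pose m p q := λ (p * tlift (fun c d => λ (d * S q) *: c) r).
pose A : 'M[k]_n := r.
pose B : 'M[k]_n := \matrix_(i, j) m (e j) (e i).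
have mE (V : lmodType k) p q (v : V) :
    tlift (fun c d => λ (p * c) *: (λ (d * S q) *: v)) r = m p q *: v.
  rewrite /m [RHS](tlift_post _ _ (g := fun z => λ (p * z) *: v)); last by repeat lin1.
  by apply: eq_tlift => c d; rewrite -scalerAr [λ (_ *: _)]linearZ scalerA mulrC.
have comul_m (V : lmodType k) q (g : H -> V) : linear g ->
    tlift (fun a b => λ (a * S q) *: g b) (Δ ℓ) = tlift (fun a b => m a q *: g b) r.
  move=> lg.
  rewrite tlift_comul_R_haar.
    apply: eq_tlift => a b; exact: mE.
  split=> [b|a]; last exact: lin_scaler lg.
  by repeat lin1.
have zero : tlift (fun a b => a ⊗ tlift (fun c d => m c b *: d) r) r = 0.
  transitivity (tlift (fun a b => tlift (fun b1 b2 =>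
      a ⊗ (λ (ℓ * S b2) *: S (S b1)) : H ⊗ H) (Δ b)) r).
    apply: eq_tlift => a b; rewrite -(comul_m _ _ idfun) // haar_mulr // comul_antipode.
    rewrite (tlift_post _ _ (g := fun t => a ⊗ tlift (fun c d => λ (ℓ * c) *: S d) t));
      last by repeat lin1.
    by apply: eq_tlift => c d; rewrite tliftE //; split; repeat lin1.
  rewrite (hexagonr_tlift (F := fun a b c => a ⊗ (λ (ℓ * S c) *: S (S b)))); try by repeat lin1.
  rewrite exchange_tlift {1}/tlift big1 // => i _; rewrite big1 // => j _.
  set c := _`_i; set d := _`_j.
  have := congr1 (tlift (fun a b => (λ b *: (a * c)) ⊗ S (S d))) R_haar_antipode.
  rewrite tliftE; last by split; repeat lin1.
  rewrite λℓ0 scale0r tlift_post; last by repeat lin1.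
  have -> : (0 : H) ⊗ S (S d) = 0 by apply/matrixP => p q; rewrite !mxE linear0 mul0r.
  move=> E; rewrite -[RHS](scaler0 _ (r i j)) -E; congr (_ *: _).
  apply: eq_tlift => a b; rewrite tliftE; last by split; repeat lin1.
  rewrite (linZ (g := fun z => z ⊗ S (S d))); last by repeat lin1.
  by rewrite (linZ (g := fun z => (a * c) ⊗ z)) //; repeat lin1.
have coord_e (i j : 'I_n) : coord (vbasis {:H}) i (e j) = (i == j)%:R.
  by rewrite coord_free ?(basis_free (vbasisP _)) // eq_sym.
have ABA : A *m B *m A = 0.
  rewrite -[RHS]zero; apply/matrixP => i j; rewrite [LHS]mxE [RHS]tlift_coef.
  rewrite [RHS](bigD1 i) //= [X in _ + X]big1 ?addr0; last first.
    move=> a /negPf ai; rewrite big1 // => b _; rewrite mxE (coord_e i a) eq_sym ai.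
    by rewrite mul0r mulr0.
  under eq_bigr => q _ do rewrite mxE mulr_suml.
  rewrite exchange_big; apply: eq_bigr => b _; rewrite mxE (coord_e i i) eqxx mul1r.
  rewrite linear_sum mulr_sumr; apply: eq_bigr => p _.
  rewrite linear_sum (bigD1 j) //= [X in _ + X]big1 ?addr0; last first.
    by move=> q /negPf qj; rewrite !linearZ /= (coord_e j q) eq_sym qj !mulr0.
  by rewrite !linearZ /= (coord_e j j) eqxx mulr1 mxE -mulrA [m _ _ * _]mulrC.
have trAB : \tr (A *m B) = 1.
  apply: (scale1_inj hλ); transitivity (tlift (fun a b => m a b *: (1 : H)) r).
    rewrite /mxtrace scaler_suml; apply: eq_bigr => i _; rewrite mxE scaler_suml.
    by apply: eq_bigr => j _; rewrite mxE scalerA.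
  transitivity (tlift (fun a b => λ (a * S b) *: (1 : H)) (Δ ℓ)).
    rewrite tlift_comul_R_haar; last by split; repeat lin1.
    by apply: eq_tlift => a b; rewrite mE.
  rewrite -(tlift_post _ _ (g := fun z => λ z *: (1 : H))); last by repeat lin1.
  by rewrite antipoder counit_R_haar scale1r (haar1 hλ) scale1r.
by move/eqP: trAB; rewrite (mxtrace_sandwich0 ABA) eq_sym oner_eq0.
Qed.

Section Modular.
Variables (M : H) (hM : forall y, λ (y * M) = ε y).
Local Notation σ := (nakayama λ M).

(** [λ ℓ 1 = r_1 λ (r_2 ℓ) = r_1 λ (ℓ σ(r_2))], where
    [σ(r_2) = S^2((r_2)_1) α((r_2)_2)] and the factor [S^2((r_2)_1)] is absorbed by
    [ℓ]; what remains is [λ ℓ (id ⊗ α)(r)]. *)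
Lemma R_modular : tlift (fun a b => ε (σ b) *: a) r = 1.
Proof.
have bλ : bilin (fun a b : H => λ b *: a) by split; repeat lin1.
have E1 := congr1 (tlift (fun a b : H => λ b *: a)) R_haar_mull.
rewrite (tlift_post _ _ (g := tlift _)) in E1; last by repeat lin1.
have E2 := congr1 (tlift (fun a b : H => λ b *: a)) R_haar_antipode2.
rewrite (tlift_post _ _ (g := tlift _)) in E2; last by repeat lin1.
rewrite tliftE // in E1; rewrite tliftE // in E2.
apply: (scalerI haar_R_haar_neq0); rewrite -[RHS]E1.
transitivity (tlift (fun a b => tlift (fun b1 b2 =>
    ε (σ b2) *: (λ (ℓ * S (S b1)) *: a)) (Δ b)) r).
  rewrite (hexagonr_tlift (F := fun a b c => ε (σ c) *: (λ (ℓ * S (S b)) *: a)));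
    try by repeat lin1.
  rewrite (tlift_post _ _ (g := fun z => λ ℓ *: z)); last exact: lin_scaler (@lin_id _ _).
  apply: eq_tlift => a b; transitivity (ε (σ b) *: (a * (λ ℓ *: 1))).
    by rewrite -scalerAr mulr1 !scalerA mulrC.
  rewrite -E2 (tlift_post _ _ (g := fun z => ε (σ b) *: (a * z))); last by repeat lin1.
  apply: eq_tlift => c d; rewrite tliftE // -scalerAr.
  by [].
apply: eq_tlift => a b; rewrite tliftE // (nakayamaE hλ hM).
rewrite {1}(nakayama_antipode hλ hM b).
rewrite [RHS](tlift_post _ _ (g := fun z => λ (ℓ * z) *: a)); last by repeat lin1.
by apply: eq_tlift => c d; rewrite -scalerAr [λ (_ *: _)]linearZ scalerA.
Qed.

(** [id ⊗ α] is multiplicative and sends [r] to [1], so it identifies [Δ] with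
    [Δ^op]. *)
Lemma modular_central h :
  tlift (fun a b => ε (σ b) *: a) (Δ h) = tlift (fun a b => ε (σ a) *: b) (Δ h).
Proof.
pose P := tlift (fun a b : H => ε (σ b) *: a).
have PM s t : P (s * t) = P s * P t.
  apply: tliftM => [|a b a' b']; first by split; repeat lin1.
  by rewrite (nakayamaM hλ hM) rmorphM -scalerA -scalerAl -scalerAr.
have := R_intertwines Rr h => /(congr1 (fun t => P (t * r))).
rewrite (mulrVK (R_unit Rr)) !PM [P r]R_modular mulr1 mul1r => E.
rewrite -[LHS]/(P (Δ h)) -E.
rewrite /P /tswap (tlift_post _ _ (g := tlift _)); last by repeat lin1.
by apply: eq_tlift => a b; rewrite tliftE //; split; repeat lin1.
Qed.

(** Centrality moves [α] to the outer leg: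
    [ε h = λ (h_1 S(h_2)) = λ (S(h_2) σ(h_1)) = α(h_1) λ (S(S(h_2) h_3)) = α h]. *)
Lemma modular_trivial h : ε (σ h) = ε h.
Proof.
have σE x : σ x = tlift (fun a b => ε (σ a) *: S (S b)) (Δ x).
  rewrite {1}(nakayama_antipode hλ hM x).
  transitivity (S (S (tlift (fun a b => ε (σ b) *: a) (Δ x)))).
    rewrite (tlift_post _ _ (g := fun z => S (S z))); last by repeat lin1.
    by apply: eq_tlift => a b; rewrite !linearZ.
  rewrite modular_central (tlift_post _ _ (g := fun z => S (S z))); last by repeat lin1.
  by apply: eq_tlift => a b; rewrite !linearZ.
symmetry; apply: (scale1_inj hλ).
transitivity (tlift (fun a b => λ (a * S b) *: (1 : H)) (Δ h)).
  rewrite -(tlift_post _ _ (g := fun z => λ z *: (1 : H))); last by repeat lin1.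
  by rewrite antipoder linearZ /= (haar1 hλ) mulr1.
transitivity (tlift (fun p b => tlift (fun c d =>
    ε (σ c) *: (λ (S (S d * b)) *: (1 : H))) (Δ p)) (Δ h)).
  apply: eq_tlift => p b; rewrite (nakayamaE hλ hM) {1}σE.
  rewrite (tlift_post _ _ (g := fun z => λ (S b * z) *: (1 : H))); last by repeat lin1.
  by apply: eq_tlift => c d; rewrite -scalerAr [λ (_ *: _)]linearZ scalerA antipodeM.
rewrite coassoc; try by repeat lin1.
rewrite (antipodel_snd (G := fun c z => ε (σ c) *: (λ (S z) *: (1 : H))));
  last by split; repeat lin1.
by rewrite antipode1 (haar1 hλ) scale1r.
Qed.

End Modular.

Theorem haar_trace x y : λ (x * y) = λ (y * S (S x)).
Proof.
have [M hM] := haar_represents_r hλ ε.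
rewrite (nakayamaE hλ hM); congr (λ (_ * _)).
rewrite (nakayama_antipode hλ hM); under eq_tlift => a b do rewrite (modular_trivial hM).
by rewrite (counitr_lin (g := fun z => S (S z))) //; repeat lin1.
Qed.

End Haar.
End RMatrix.

(** * Twisting the coseparability pairing *)

Section HaarCosep.
Variables (k : fieldType) (H : hopfAlgebra k) (λ : {scalar H}).
Hypothesis hλ : haar_integral λ.
Local Notation "'Δ'" := (@comul k H).
Local Notation ε := (@counit k H).
Local Notation S := (@antipode k H).

Definition haar_pairing (t : H ⊗ H) : k := λ (tlift (fun a b => a * S b) t).

Lemma lin_haar_pairing : scalar haar_pairing.
Proof.
have l : linear (fun t : H ⊗ H => tlift (fun a b => a * S b) t) by repeat lin1.
by move=> c u v; rewrite /haar_pairing l linearP.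
Qed.

HB.instance Definition _ :=
  GRing.isLinear.Build k (H ⊗ H)%type k _ haar_pairing lin_haar_pairing.

Lemma haar_pairingE a b : haar_pairing (a ⊗ b) = λ (a * S b).
Proof. by rewrite /haar_pairing tliftE //; split; repeat lin1. Qed.

Lemma haar_coseparability : coseparability haar_pairing.
Proof.
split=> [x|x y].
  by rewrite /= /haar_pairing antipoder linearZ /= (haar1 hλ) mulr1.
under eq_tlift => a b do rewrite /= haar_pairingE.
by rewrite haar_antipode //; apply: eq_tlift => a b; rewrite /= haar_pairingE.
Qed.

Lemma haar_pairing_comulr t b : haar_pairing (t * Δ b) = ε b * haar_pairing t.
Proof.
apply: (scale1_inj hλ); move: t; apply: tens_ext => [||p q].
- by repeat lin1.
- by move=> c u v; rewrite linearP mulrDr scalerDl mulrCA scalerA.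
rewrite haar_pairingE /haar_pairing tlift_mul; last by split; repeat lin1.
rewrite tliftE; last by split; repeat lin1.
under eq_tlift => c d do rewrite antipodeM mulrA -(mulrA p).
rewrite -(tlift_post _ _ (g := fun z => p * z * S q)); last by repeat lin1.
by rewrite antipoder -scalerAr mulr1 -scalerAl linearZ.
Qed.

Hypothesis trλ : forall x y, λ (x * y) = λ (y * S (S x)).

(** The trace property brings the outer factor [S(a_2)] of
    [λ (a_1 p S(q) S(a_2))] next to [a_1], as [S(a_2) S^2(a_1)]. *)
Lemma haar_pairing_comull a t : haar_pairing (Δ a * t) = ε a * haar_pairing t.
Proof.
apply: (scale1_inj hλ); move: t; apply: tens_ext => [||p q].
- by repeat lin1.
- by move=> c u v; rewrite linearP mulrDr scalerDl mulrCA scalerA.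
rewrite haar_pairingE /haar_pairing tlift_mul; last by split; repeat lin1.
transitivity (λ (p * S q * S (tlift (fun c d => S c * d) (Δ a))) *: (1 : H)); last first.
  by rewrite antipodel linearZ /= antipode1 -scalerAr mulr1 linearZ.
rewrite [LHS](tlift_post _ _ (g := fun z => λ z *: (1 : H))); last by repeat lin1.
rewrite [RHS](tlift_post _ _ (g := fun z => λ (p * S q * S z) *: (1 : H))); last by repeat lin1.
apply: eq_tlift => c d; rewrite tliftE; last by split; repeat lin1.
by rewrite -mulrA trλ !antipodeM !mulrA.
Qed.

End HaarCosep.

Section Legs.
Variables (k : fieldType) (H : hopfAlgebra k).
Local Notation "'Δ'" := (@comul k H).
Local Notation ε := (@counit k H).
Local Notation H3 := (H ⊗ (H ⊗ H))%type.
Let I : {lrmorphism H -> H} := idfun.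

(** All computations with three tensor factors take place in
    [H ⊗ (H ⊗ H)]; the maps acting on the first two factors are transported
    along the associator, which keeps them multiplicative by construction. *)
Definition comul12 (t : H ⊗ H) : H3 := tassoc (tmap Δ idfun t).
Definition comul23 (t : H ⊗ H) : H3 := tmap idfun Δ t.
Definition leg12 (t : H ⊗ H) : H3 := tassoc (t ⊗ 1).

Lemma comul12M s t : comul12 (s * t) = comul12 s * comul12 t.
Proof. by rewrite /comul12 (tmapM Δ I) tassocM. Qed.
Lemma comul23M s t : comul23 (s * t) = comul23 s * comul23 t.
Proof. by rewrite /comul23 (tmapM I Δ). Qed.
Lemma leg12M s t : leg12 (s * t) = leg12 s * leg12 t.
Proof. by rewrite /leg12 -tassocM ptensM mulr1. Qed.
Lemma R23M (s t : H ⊗ H) : R23 (s * t) = R23 s * R23 t.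
Proof. by rewrite /R23 ptensM mulr1. Qed.
Lemma comul12_1 : comul12 1 = 1.
Proof. by rewrite /comul12 (tmap1 Δ I) tassoc1. Qed.
Lemma comul23_1 : comul23 1 = 1.
Proof. exact: (tmap1 I Δ). Qed.
Lemma leg12_1 : leg12 1 = 1.
Proof. by rewrite /leg12 ptens1 tassoc1. Qed.
Lemma R23_1 : R23 (1 : H ⊗ H) = 1.
Proof. exact: ptens1. Qed.
Lemma lin_comul12 : linear comul12.
Proof. by apply: lin_comp; [exact: tassoc_lin|rewrite /tmap; repeat lin1]. Qed.
Lemma lin_comul23 : linear comul23.
Proof. by rewrite /comul23 /tmap; repeat lin1. Qed.
Lemma lin_leg12 : linear leg12.
Proof. by apply: lin_comp; [exact: tassoc_lin|repeat lin1]. Qed.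
Lemma lin_R23 : linear (@R23 k H).
Proof. by rewrite /R23; repeat lin1. Qed.

Lemma comul12E a b : comul12 (a ⊗ b) = tassoc (Δ a ⊗ b).
Proof. by rewrite /comul12 (tmapE Δ I). Qed.
Lemma comul23E a b : comul23 (a ⊗ b) = a ⊗ Δ b.
Proof. by rewrite /comul23 (tmapE I Δ). Qed.

Lemma tens3_ext (V : lmodType k) (f g : H3 -> V) :
    linear f -> linear g -> (forall a b c, f (a ⊗ (b ⊗ c)) = g (a ⊗ (b ⊗ c))) ->
  forall t, f t = g t.
Proof.
move=> lf lg fg; apply: tens_ext => // a bc; move: bc.
by apply: (@tens_ext _ _ _ _ (fun bc => f (a ⊗ bc)) (fun bc => g (a ⊗ bc))) => //;
  apply: lin_comp => //; repeat lin1.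
Qed.

Section Contraction.
Variable (τ : {scalar (H ⊗ H)%type}).

(** [id ⊗ τ] and [τ ⊗ id]. *)
Definition contract23 (w : H3) : H := tlift (fun a bc => τ bc *: a) w.
Definition contract12 (w : H3) : H :=
  tlift (fun a bc => tlift (fun b c => τ (a ⊗ b) *: c) bc) w.

Lemma lin_contract23 : linear contract23.
Proof. by rewrite /contract23; repeat lin1. Qed.
Lemma lin_contract12 : linear contract12.
Proof. by rewrite /contract12; repeat lin1. Qed.

Lemma contract23E a t : contract23 (a ⊗ t) = τ t *: a.
Proof. by rewrite /contract23 tliftE //; split; repeat lin1. Qed.

Lemma contract12E t c : contract12 (tassoc (t ⊗ c)) = τ t *: c.
Proof.
move: t; apply: tens_ext => [||a b].
- by apply: lin_comp; [exact: lin_contract12|apply: lin_comp; [exact: tassoc_lin|repeat lin1]].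
- by repeat lin1.
by rewrite tassocE /contract12 !tliftE //; split; repeat lin1.
Qed.

(** The shift property, extended from [x ⊗ y] to all tensors:
    [(id ⊗ τ) (Δ ⊗ id) = (τ ⊗ id) (id ⊗ Δ)]. *)
Lemma contract_shift : coseparability τ ->
  forall t, contract23 (comul12 t) = contract12 (comul23 t).
Proof.
move=> cosep; apply: tens_ext => [||x y].
- by apply: lin_comp lin_contract23 lin_comul12.
- by apply: lin_comp lin_contract12 lin_comul23.
rewrite comul12E comul23E.
transitivity (tlift (fun a b => τ (b ⊗ y) *: a) (Δ x)).
  rewrite -[in LHS](tens_decomp (Δ x)).
  rewrite (tlift_post _ _ (g := fun z => contract23 (tassoc (z ⊗ y)))); last first.
    by apply: lin_comp lin_contract23 _; apply: lin_comp; [exact: tassoc_lin|repeat lin1].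
  by apply: eq_tlift => a b; rewrite tassocE contract23E.
rewrite (cosep_shift cosep) -[in RHS](tens_decomp (Δ y)).
rewrite (tlift_post _ _ (g := fun z => contract12 (x ⊗ z))); last first.
  by apply: lin_comp lin_contract12 _; repeat lin1.
by apply: eq_tlift => a b; rewrite -tassocE contract12E.
Qed.

Hypothesis τl : forall a t, τ (Δ a * t) = ε a * τ t.
Hypothesis τr : forall t b, τ (t * Δ b) = ε b * τ t.

Lemma contract23_comul s w t :
  contract23 (comul23 s * w * comul23 t) =
  tlift (fun a b => ε b *: a) s * contract23 w * tlift (fun a b => ε b *: a) t.
Proof.
have lc (X : lmodType k) (f : X -> H3) : linear f -> linear (fun x => contract23 (f x)).
  exact: lin_comp lin_contract23.
have lB (X : lmodType k) (f : X -> (H ⊗ H)%type) :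
  linear f -> linear (fun x => comul23 (f x)) by exact: lin_comp lin_comul23.
move: s; apply: tens_ext => [||a b]; try by do ?[lin1 | apply: lc | apply: lB].
move: t; apply: tens_ext => [||a' b']; try by do ?[lin1 | apply: lc | apply: lB].
move: w; apply: tens_ext => [||c v]; try by do ?[lin1 | apply: lc].
rewrite !comul23E !ptensM !contract23E τr τl !tliftE; try by split; repeat lin1.
by rewrite -!scalerAl -!scalerAr -!scalerAl !scalerA mulrCA [in LHS]mulrA.
Qed.

Lemma contract12_comul s w t :
  contract12 (comul12 s * w * comul12 t) =
  tlift (fun a b => ε a *: b) s * contract12 w * tlift (fun a b => ε a *: b) t.
Proof.
have lc (X : lmodType k) (f : X -> H3) : linear f -> linear (fun x => contract12 (f x)).
  exact: lin_comp lin_contract12.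
have lA (X : lmodType k) (f : X -> (H ⊗ H)%type) :
  linear f -> linear (fun x => comul12 (f x)) by exact: lin_comp lin_comul12.
move: s; apply: tens_ext => [||a b]; try by do ?[lin1 | apply: lc | apply: lA].
move: t; apply: tens_ext => [||a' b']; try by do ?[lin1 | apply: lc | apply: lA].
move: w; apply: tens3_ext => [||x y z]; try by do ?[lin1 | apply: lc].
rewrite -tassocE !comul12E -!tassocM !ptensM !contract12E τr τl !tliftE; try by split; repeat lin1.
by rewrite -!scalerAl -!scalerAr -!scalerAl !scalerA mulrCA [in LHS]mulrA.
Qed.

End Contraction.

Section Twisted.
Variables (J : H ⊗ H) (twJ : is_twist J).
Local Notation K := (J^-1).
Let uJ := twist_unit twJ.

Lemma twist_legs : comul12 J * leg12 J = comul23 J * R23 J.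
Proof. by rewrite /comul12 /leg12 -tassocM; exact: twist_cocycle twJ. Qed.

Lemma twist_legsVl : R23 J * leg12 K = comul23 K * comul12 J.
Proof.
have E := congr1 (fun w => comul23 K * w * leg12 K) twist_legs.
rewrite /= !mulrA -comul23M mulVr // comul23_1 mul1r in E.
by rewrite -E -mulrA -leg12M mulrV // leg12_1 mulr1.
Qed.

Lemma twist_legsVr : leg12 J * R23 K = comul12 K * comul23 J.
Proof.
have E := congr1 (fun w => comul12 K * w * R23 K) twist_legs.
rewrite /= !mulrA -comul12M mulVr // comul12_1 mul1r in E.
by rewrite E -mulrA -R23M mulrV // R23_1 mulr1.
Qed.

Lemma twist_legsV : leg12 K * comul12 K = R23 K * comul23 K.
Proof.
have h1 : leg12 K * comul12 K * (comul12 J * leg12 J) = 1.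
  rewrite mulrA -(mulrA (leg12 K)) -comul12M mulVr // comul12_1 mulr1.
  by rewrite -leg12M mulVr // leg12_1.
have h2 : comul23 J * R23 J * (R23 K * comul23 K) = 1.
  rewrite mulrA -(mulrA (comul23 J)) -R23M mulrV // R23_1 mulr1.
  by rewrite -comul23M mulrV // comul23_1.
by rewrite -[LHS]mulr1 -h2 mulrA -twist_legs h1 mul1r.
Qed.

Let T : hopfAlgebra k := twistedHopf twJ.

Section TwistedPairing.
Variable (τ : {scalar (H ⊗ H)%type}).

Definition twist_pairing (t : H ⊗ H) : k := τ (J * t * K).

Lemma lin_twist_pairing : scalar twist_pairing.
Proof. by move=> c u v; rewrite /twist_pairing mulrDr mulrDl -scalerAr -scalerAl linearP. Qed.

HB.instance Definition _ :=
  GRing.isLinear.Build k (H ⊗ H)%type k _ twist_pairing lin_twist_pairing.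

Lemma contract23_twist t y :
  tlift (fun a b => twist_pairing (b ⊗ y) *: a) t =
  contract23 τ (R23 J * tassoc (t ⊗ y) * R23 K).
Proof.
move: t; apply: tens_ext => [||a b].
- by repeat lin1.
- apply: lin_comp (lin_contract23 τ) _; apply: lin_mull; apply: lin_mulr.
  by apply: lin_comp (@tassoc_lin _ _ _ _) _; repeat lin1.
rewrite tassocE /R23 !ptensM mul1r mulr1 contract23E tliftE //.
by split; repeat lin1.
Qed.

Lemma contract12_twist x t :
  tlift (fun a b => twist_pairing (x ⊗ a) *: b) t =
  contract12 τ (leg12 J * (x ⊗ t) * leg12 K).
Proof.
move: t; apply: tens_ext => [||a b].
- by repeat lin1.
- by apply: lin_comp (lin_contract12 τ) _; repeat lin1.
rewrite -tassocE /leg12 -!tassocM !ptensM mul1r mulr1 contract12E tliftE //.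
by split; repeat lin1.
Qed.

Hypothesis τl : forall a t, τ (Δ a * t) = ε a * τ t.
Hypothesis τr : forall t b, τ (t * Δ b) = ε b * τ t.

(** Both sides of the shift property of [τ_J] at [x ⊗ y] are contractions in
    [H ⊗ (H ⊗ H)]. With [X = J (x ⊗ y) K] and [K = J^-1], the twist equation
    rewrites them as
    [(id ⊗ τ) ((id ⊗ Δ)(K) (Δ ⊗ id)(X) (id ⊗ Δ)(J))] and
    [(τ ⊗ id) ((Δ ⊗ id)(K) (id ⊗ Δ)(X) (Δ ⊗ id)(J))]; the outer factors
    disappear by the invariance of [τ] and the normalization of [J]. *)
Lemma twist_coseparability :
  coseparability τ -> coseparability (H := T) twist_pairing.
Proof.
move=> cosep; split=> [x|x y].
  rewrite -[LHS]/(τ (J * (K * Δ x * J) * K)) !mulrA mulrV // mul1r mulrK //.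
  exact: cosep_counit cosep x.
transitivity (contract23 τ (R23 J * tassoc ((K * Δ x * J) ⊗ (y : H)) * R23 K)).
  exact: contract23_twist.
transitivity (contract12 τ (leg12 J * ((x : H) ⊗ (K * Δ y * J)) * leg12 K)); last first.
  by symmetry; exact: contract12_twist.
have -> : tassoc ((K * Δ x * J) ⊗ (y : H)) = leg12 K * comul12 (x ⊗ y) * leg12 J.
  by rewrite comul12E /leg12 -!tassocM !ptensM mul1r mulr1.
have -> : (x : H) ⊗ (K * Δ y * J) = R23 K * comul23 (x ⊗ y) * R23 J.
  by rewrite comul23E /R23 !ptensM mul1r mulr1.
transitivity (contract23 τ (comul23 K * comul12 (J * (x ⊗ y) * K) * comul23 J)).
  congr contract23; rewrite !mulrA twist_legsVl -!mulrA twist_legsVr.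
  by rewrite !comul12M !mulrA.
transitivity (contract12 τ (comul12 K * comul23 (J * (x ⊗ y) * K) * comul12 J)); last first.
  congr contract12; rewrite !mulrA twist_legsVr -!mulrA twist_legsVl.
  by rewrite !comul23M !mulrA.
rewrite contract23_comul // contract12_comul //.
rewrite (twistV_counitr twJ) (twistV_counitl twJ) (twist_counitl twJ) (twist_counitr twJ).
by rewrite !mul1r !mulr1 contract_shift.
Qed.

End TwistedPairing.

End Twisted.
End Legs.

(** * Twisting the R-matrix *)

(** The noncommutative rearrangement shared by the two hexagon equations of
    the twisted R-matrix. *)
Lemma hexagon_factors (A : pzRingType)
    (k0 k1 k2 r1 r2 j0 j1 j2 j3 j4 s x y z : A) :
    k0 * k1 = k2 * x -> x * r1 = r1 * y -> r2 * j2 = z * r2 -> y * z = j4 * s ->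
    j1 * j0 = j2 * j3 ->
  k0 * (k1 * (r1 * r2) * j1) * j0 = k2 * (r1 * j4) * (s * (r2 * j3)).
Proof.
move=> kx xr rz yz jj.
transitivity (k0 * k1 * r1 * (r2 * (j1 * j0))); first by rewrite !mulrA.
rewrite jj kx -(mulrA k2) xr (mulrA r2) rz.
transitivity (k2 * r1 * (y * z) * r2 * j3); first by rewrite !mulrA.
by rewrite yz !mulrA.
Qed.

Section Permutations.
Variables (k : fieldType) (H : hopfAlgebra k).
Local Notation "'Δ'" := (@comul k H).
Local Notation H3 := (H ⊗ (H ⊗ H))%type.

Lemma tswapE (a b : H) : tswap (a ⊗ b) = b ⊗ a.
Proof. by rewrite /tswap tliftE //; split; repeat lin1. Qed.

Lemma lin_tswap : linear (@tswap k H H).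
Proof. by rewrite /tswap; repeat lin1. Qed.

Lemma tswapM (s t : H ⊗ H) : tswap (s * t) = tswap s * tswap t.
Proof.
by apply: tliftM => [|a b a' b']; [split; repeat lin1|rewrite ptensM].
Qed.

Lemma tswap1 : tswap (1 : H ⊗ H) = 1.
Proof. by rewrite -ptens1 tswapE. Qed.

Definition swap23 (w : H3) : H3 := tlift (fun a bc => a ⊗ tswap bc) w.
Definition swap12 (w : H3) : H3 :=
  tlift (fun a bc => tlift (fun b c => b ⊗ (a ⊗ c)) bc) w.

Let lin_sw (X : lmodType k) (f : X -> (H ⊗ H)%type) :
  linear f -> linear (fun x => tswap (f x)).
Proof. exact: lin_comp lin_tswap. Qed.

Lemma lin_swap23 : linear swap23.
Proof. by rewrite /swap23; repeat lin1. Qed.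
Lemma lin_swap12 : linear swap12.
Proof. by rewrite /swap12; repeat lin1. Qed.

Lemma swap23E a t : swap23 (a ⊗ t) = a ⊗ tswap t.
Proof. by rewrite /swap23 tliftE //; split=> z; do ?[apply: lin_sw | lin1]. Qed.

Lemma swap12_assoc t c : swap12 (tassoc (t ⊗ c)) = tassoc (tswap t ⊗ c).
Proof.
move: t; apply: tens_ext => [||a b].
- by apply: lin_comp lin_swap12 _; apply: lin_comp (@tassoc_lin _ _ _ _) _; repeat lin1.
- by apply: lin_comp (@tassoc_lin _ _ _ _) _; apply: lin_ptensl; apply: lin_tswap.
by rewrite tswapE !tassocE /swap12 !tliftE //; split; repeat lin1.
Qed.

Lemma swap12E a b c : swap12 (a ⊗ (b ⊗ c)) = b ⊗ (a ⊗ c).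
Proof. by rewrite -tassocE swap12_assoc tswapE tassocE. Qed.

Lemma swap23M v w : swap23 (v * w) = swap23 v * swap23 w.
Proof.
apply: tliftM => [|a b a' b'].
  by split=> z; do ?[apply: lin_sw | lin1].
by rewrite tswapM ptensM.
Qed.

Lemma swap12M v w : swap12 (v * w) = swap12 v * swap12 w.
Proof.
have l := lin_comp lin_swap12.
move: v; apply: tens3_ext => [||a b c].
- by apply: l; repeat lin1.
- by apply: lin_mull; exact: lin_swap12.
move: w; apply: tens3_ext => [||a' b' c'].
- by apply: l; repeat lin1.
- by apply: lin_mulr; exact: lin_swap12.
by rewrite !ptensM !swap12E !ptensM.
Qed.

Lemma swap23_R23 (t : H ⊗ H) : swap23 (R23 t) = R23 (tswap t).
Proof. exact: swap23E. Qed.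

Lemma swap12_leg12 (t : H ⊗ H) : swap12 (leg12 t) = leg12 (tswap t).
Proof. exact: swap12_assoc. Qed.

Lemma swap23_leg12 t : swap23 (leg12 t) = R13 t.
Proof.
move: t; apply: tens_ext => [||a b].
- by apply: lin_comp lin_swap23 (@lin_leg12 _ _).
- by rewrite /R13 /tmap; repeat lin1.
rewrite /leg12 tassocE swap23E tswapE /R13 /tmap tliftE //.
by split; repeat lin1.
Qed.

Lemma swap12_R23 (t : H ⊗ H) : swap12 (R23 t) = R13 t.
Proof.
move: t; apply: tens_ext => [||a b].
- by apply: lin_comp lin_swap12 (@lin_R23 _ _).
- by rewrite /R13 /tmap; repeat lin1.
rewrite /R23 swap12E /R13 /tmap tliftE //.
by split; repeat lin1.
Qed.

Lemma R12_leg12 (t : H ⊗ H) : R12 t = leg12 t.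
Proof.
move: t; apply: tens_ext => [||a b].
- by rewrite /R12 /tmap; repeat lin1.
- exact: lin_leg12.
rewrite /leg12 tassocE /R12 /tmap tliftE //.
by split; repeat lin1.
Qed.

Lemma swap23K : involutive swap23.
Proof.
apply: tens3_ext => [||a b c]; last by rewrite !swap23E !tswapE.
- by apply: lin_comp lin_swap23 lin_swap23.
- exact: lin_id.
Qed.

Lemma swap12K : involutive swap12.
Proof.
apply: tens3_ext => [||a b c]; last by rewrite !swap12E.
- by apply: lin_comp lin_swap12 lin_swap12.
- exact: lin_id.
Qed.

Lemma comul12_swap t : comul12 (tswap t) = swap23 (swap12 (comul23 t)).
Proof.
move: t; apply: tens_ext => [||a b].
- by apply: lin_comp (@lin_comul12 _ _) lin_tswap.
- by apply: lin_comp lin_swap23 _; apply: lin_comp lin_swap12 (@lin_comul23 _ _).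
rewrite tswapE comul12E comul23E; move: (Δ b); apply: tens_ext => [||c d].
- by apply: lin_comp (@tassoc_lin _ _ _ _) _; repeat lin1.
- by apply: lin_comp lin_swap23 _; apply: lin_comp lin_swap12 _; repeat lin1.
by rewrite tassocE swap12E swap23E tswapE.
Qed.

Lemma comul23_swap t : comul23 (tswap t) = swap12 (swap23 (comul12 t)).
Proof.
move: t; apply: tens_ext => [||a b].
- by apply: lin_comp (@lin_comul23 _ _) lin_tswap.
- by apply: lin_comp lin_swap12 _; apply: lin_comp lin_swap23 (@lin_comul12 _ _).
rewrite tswapE comul12E comul23E; move: (Δ a); apply: tens_ext => [||c d].
- by repeat lin1.
- by apply: lin_comp lin_swap12 _; apply: lin_comp lin_swap23 _;
    apply: lin_comp (@tassoc_lin _ _ _ _) _; repeat lin1.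
by rewrite tassocE swap23E tswapE swap12E.
Qed.

Section RTwist.
Variables (r : H ⊗ H) (Rr : universal_R r).
Variables (J : H ⊗ H) (twJ : is_twist J).
Local Notation K := (J^-1).
Let uJ := twist_unit twJ.
Let ur := R_unit Rr.

Lemma R_comul h : tswap (Δ h) * r = r * Δ h.
Proof. by rewrite (R_intertwines Rr) mulrVK. Qed.

(** [Δ^op r = r Δ] in the first two factors. *)
Lemma R_comul12 t : swap12 (comul12 t) * leg12 r = leg12 r * comul12 t.
Proof.
move: t; apply: tens_ext => [||a b].
- by apply: lin_mull; apply: lin_comp lin_swap12 (@lin_comul12 _ _).
- by apply: lin_mulr; exact: lin_comul12.
rewrite comul12E swap12_assoc /leg12 -!tassocM !ptensM R_comul.
by rewrite mul1r mulr1.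
Qed.

Lemma R_comul23 t : swap23 (comul23 t) * R23 r = R23 r * comul23 t.
Proof.
move: t; apply: tens_ext => [||a b].
- by apply: lin_mull; apply: lin_comp lin_swap23 (@lin_comul23 _ _).
- by apply: lin_mulr; exact: lin_comul23.
by rewrite comul23E swap23E /R23 !ptensM R_comul mul1r mulr1.
Qed.

Let rJ : H ⊗ H := tswap K * r * J.

Let R13M (s t : H ⊗ H) : R13 (s * t) = R13 s * R13 t.
Proof. by rewrite -!swap23_leg12 leg12M swap23M. Qed.

Let R13_rJ : R13 rJ = R13 (tswap K) * (R13 r * R13 J).
Proof. by rewrite -!R13M mulrA. Qed.

(** With legs as superscripts and [K = J^-1], the four factors are
    [K^12 (Δ ⊗ id)(K^21) = K^31 K^(31,2)], [K^(31,2) r^13 = r^13 K^(13,2)],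
    [r^23 J^(1,23) = J^(1,32) r^23] and [K^(13,2) J^(1,32) = J^13 K^32]: two
    permuted twist equations and two intertwinings. *)
Lemma twisted_hexagonl :
  leg12 K * comul12 rJ * leg12 J = R13 rJ * R23 rJ.
Proof.
have -> : comul12 rJ = comul12 (tswap K) * (R13 r * R23 r) * comul12 J.
  by rewrite !comul12M -(R_hexagonl Rr).
have -> : R23 rJ = R23 (tswap K) * (R23 r * R23 J) by rewrite -!R23M mulrA.
rewrite R13_rJ; apply: (hexagon_factors _ _ _ _ (twist_legs twJ)
  (x := swap23 (swap12 (comul12 K))) (y := swap23 (comul12 K)) (z := swap23 (comul23 J))).
- rewrite comul12_swap -[leg12 K]swap23K swap23_leg12 -swap12_R23.
  rewrite -swap23M -swap12M -(twist_legsV twJ) swap12M swap23M swap12_leg12.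
  by rewrite swap23_leg12.
- by rewrite -swap23_leg12 -!swap23M R_comul12.
- by rewrite R_comul23.
- by rewrite -swap23M -(twist_legsVr twJ) swap23M swap23_leg12 swap23_R23.
Qed.

(** The mirror image: [K^23 (id ⊗ Δ)(K^21) = K^31 K^(2,31)],
    [K^(2,31) r^13 = r^13 K^(2,13)], [r^12 J^(12,3) = J^(21,3) r^12] and
    [K^(2,13) J^(21,3) = J^13 K^21]. *)
Lemma twisted_hexagonr :
  R23 K * comul23 rJ * R23 J = R13 rJ * leg12 rJ.
Proof.
have -> : comul23 rJ = comul23 (tswap K) * (R13 r * leg12 r) * comul23 J.
  by rewrite !comul23M -R12_leg12 -(R_hexagonr Rr).
have -> : leg12 rJ = leg12 (tswap K) * (leg12 r * leg12 J) by rewrite -!leg12M mulrA.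
rewrite R13_rJ; apply: (hexagon_factors _ _ _ _ (esym (twist_legs twJ))
  (x := swap12 (swap23 (comul23 K))) (y := swap12 (comul23 K)) (z := swap12 (comul12 J))).
- rewrite comul23_swap -[R23 K]swap12K swap12_R23 -swap23_leg12.
  rewrite -swap12M -swap23M (twist_legsV twJ) swap23M swap12M swap23_R23.
  by rewrite swap12_R23.
- by rewrite -swap12_R23 -!swap12M R_comul23.
- by rewrite R_comul12.
- by rewrite -swap12M -(twist_legsVl twJ) swap12M swap12_R23 swap12_leg12.
Qed.

Let T : hopfAlgebra k := twistedHopf twJ.

Lemma twisted_universal_R : universal_R (H := T) rJ.
Proof.
have uK : tswap K * tswap J = 1 by rewrite -tswapM mulVr // tswap1.
have uK' : tswap J * tswap K = 1 by rewrite -tswapM mulrV // tswap1.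
have urJ : rJ \is a GRing.unit.
  rewrite /rJ !unitrMl //.
  by apply/unitrP; exists (tswap J).
split=> [//|h||].
- rewrite -[RHS]/(rJ * (K * Δ h * J) * rJ^-1) -[LHS]/(tswap (K * Δ h * J)).
  apply: (mulIr urJ); rewrite mulrVK // !tswapM /rJ !mulrA mulrK //.
  rewrite -(mulrA _ (tswap J)) uK' mulr1 -!mulrA; congr (_ * _).
  by rewrite !mulrA R_comul.
- rewrite -[RHS]/(R13 rJ * R23 rJ) -twisted_hexagonl.
  rewrite -[LHS]/(tassoc (tmap (twist_comul J) idfun rJ)).
  move: rJ; apply: tens_ext => [||a b].
  + by apply: lin_comp (@tassoc_lin _ _ _ _) _; rewrite /tmap; repeat lin1.
  + by apply: lin_mull; apply: lin_mulr; exact: lin_comul12.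
  rewrite comul12E /leg12 -!tassocM !ptensM mul1r mulr1; congr tassoc.
  by rewrite /tmap tliftE //; split; repeat lin1.
- rewrite -[RHS]/(R13 rJ * R12 rJ) R12_leg12 -twisted_hexagonr.
  rewrite -[LHS]/(tmap idfun (twist_comul J) rJ).
  move: rJ; apply: tens_ext => [||a b].
  + by rewrite /tmap; repeat lin1.
  + by apply: lin_mull; apply: lin_mulr; exact: lin_comul23.
  rewrite comul23E /R23 !ptensM mul1r mulr1.
  by rewrite /tmap tliftE //; split; repeat lin1.
Qed.

End RTwist.
End Permutations.

Theorem mainTheorem3 (k : closedFieldType) (H : hopfAlgebra k)
    (J : H ⊗ H) (twJ : is_twist J) :
  cosemisimple H -> quasitriangular H ->
  cosemisimple (twistedHopf twJ) /\ quasitriangular (twistedHopf twJ).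
Proof.
move=> /cosemisimple_haar[λ hλ] [r Rr]; split; last first.
  by exists (tswap J^-1 * r * J); exact: twisted_universal_R.
apply: coseparable_cosemisimple (twist_coseparability twJ _ _ (haar_coseparability hλ)).
- by move=> a t; apply: haar_pairing_comull hλ (haar_trace Rr hλ) a t.
- by move=> t b; apply: haar_pairing_comulr hλ t b.
Qed.
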